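(* Let $k \geq 3$ be an integer and let $\varepsilon > 0$. Then there exist nonzero integers $a_1, \dots, a_k$ with the property that, for any suitably large finite set $S \subseteq \mathbb{Z}$, $$T(S) \leq \left(\frac{\sigma_k}{k^{k-1}} + \varepsilon\right)|S|^{k-1} + o(|S|^{k-1}),$$ where the $o(|S|^{k-1})$ term is bounded by $f(|S|)\,|S|^{k-1}$ for some function $f$ (which may depend on $k,\varepsilon,a_1,\dots,a_k$ but not otherwise on $S$) with $f(n) \to 0$ as $n\to\infty$, and ''suitably large'' means $|S| \geq N$ for some $N$ depending only on $k,\varepsilon,a_1,\dots,a_k$.
   Context: For a finite set $S \subseteq \mathbb{Z}$, $T(S)$ denotes the number of $k$-tuples $(x_1,\dots,x_k) \in S^k$ with $a_1x_1+\dots+a_kx_k=0$. For $x>0$, $I_x : \mathbb{R} \to \mathbb{R}$ is the indicator function of the interval of length $x$ centred at the origin: $I_x(y)=1$ if $|y| \leq x/2$ and $I_x(y)=0$ otherwise. For $k\geq 3$, $\sigma_k = (I_1 \ast \dots \ast I_1)(0)$, the $k$-fold convolution on $\mathbb{R}$ evaluated at $0$; equivalently $\sigma_k = \int_{-\infty}^{\infty} \left(\frac{\sin \pi x}{\pi x}\right)^k dx$. *)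

(* Defs.v *)
From HB Require Import structures.
From mathcomp Require Import all_boot all_order all_algebra finmap.
From mathcomp Require Import all_classical all_reals all_analysis.
Set Implicit Arguments.
Unset Strict Implicit.
Unset Printing Implicit Defensive.
Import Order.TTheory GRing.Theory Num.Theory.
Import numFieldNormedType.Exports.
Local Open Scope fset_scope.
Local Open Scope classical_set_scope.
Local Open Scope ring_scope.

Definition num_solutions (k : nat) (a : 'I_k -> int) (S : {fset int}) : nat :=
  #|[set x : {ffun 'I_k -> S} | \sum_(i < k) a i * val (x i) == 0]%SET|.

Definition interval_indic (R : realType) (x : R) : R -> R :=
  \1_[set y : R | `|y| <= x / 2].

Definition convolution (R : realType) (f g : R -> R) : R -> R :=
  fun x => \int[@lebesgue_measure R]_y (f y * g (x - y)).

(* The convolution of k copies of f, i.e. k.-1 convolution operations;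
   only meaningful for k > 0. *)
Definition convolution_pow (R : realType) (f : R -> R) (k : nat) : R -> R :=
  iter k.-1 (convolution f) f.

Definition sigma (R : realType) (k : nat) : R :=
  convolution_pow (interval_indic 1) k 0.

(* Main.v *)
(* For large distinct primes p and q take a_i = p^i, except a_0 = q.

   For a prime p, cut the tree of residue classes of S modulo powers of p at
   the depth where classes have fewer than |S| / d^r elements.  In almost every
   solution, for a suitable r, all the a_i x_i are cut at the same depth.
   Indeed, sum b / (a + b) over all tuples, a and b being the sizes of the
   classes at the cut of one free coordinate and of the coordinate determined by
   the others.  This potential is bounded and decreases with r, and if it stays
   nearly constant between two levels, the relative sizes of the subclasses of
   two matched classes agree.  Replacing a third coordinate by another element
   of its class shifts the matching, so these sizes are almost invariant under a
   translation of order p, and for p large they would add up to more than the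
   whole class.  So for some r almost no tuple has all its classes of size about
   |S| / d^r at the cut; in the other tuples the classes either are all cut or
   have very different sizes, and the latter are rare as well.

   In the remaining solutions the p-depths of x_0, ..., x_(k-1) go down by one at
   each step, and the q-depths are equal except for x_0.  Put
   g1 = const - p-depth and g2 = const - q-depth.  Colouring S by g1 mod k makes
   these solutions rainbow, and the injection
     x |-> p^(g1 x) q^(g2 x) x + M 2^(g1 x) (2 - 2^k)^(g2 x),
   with M large, maps them to zero-sum tuples of k fixed disjoint sets of total
   size |S|.  Such tuples are counted by the section of a box by the hyperplane
   of zero coordinate sum, up to lower order terms.  For a given total side
   length that section is largest for a cube, where it is
   sigma_k / k^(k-1) |S|^(k-1). *)

Require Import Defs.
From HB Require Import structures.
From mathcomp Require Import all_boot all_order all_algebra finmap.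
From mathcomp Require Import all_classical all_reals all_analysis.
From mathcomp Require Import zify ring lra.
Import Order.TTheory GRing.Theory Num.Theory.
Import numFieldNormedType.Exports.
Local Open Scope fset_scope.
Local Open Scope classical_set_scope.
Local Open Scope ring_scope.
Set Implicit Arguments.
Unset Strict Implicit.
Unset Printing Implicit Defensive.

(** * Residue classes modulo powers of p *)

Section Congruence.
Variable p : nat.

Definition cong (s : nat) (g h : int) : bool := ((p ^ s)%N %| g - h)%Z.

Lemma cong_refl s g : cong s g g. Proof. by rewrite /cong subrr dvdz0. Qed.

Lemma cong_sym s g h : cong s g h = cong s h g.
Proof. by rewrite /cong -opprB rpredN. Qed.

Lemma cong_trans s h g l : cong s g h -> cong s h l -> cong s g l.
Proof. by rewrite /cong => gh hl; rewrite -(subrK h g) -addrA rpredD. Qed.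

Lemma congl s g h l : cong s g h -> cong s g l = cong s h l.
Proof.
by move=> gh; apply/idP/idP; apply: cong_trans; rewrite // cong_sym.
Qed.

Lemma congr s g h l : cong s g h -> cong s l g = cong s l h.
Proof. by move=> gh; rewrite ![cong s l _]cong_sym; exact: congl. Qed.

Lemma cong_le s t g h : (t <= s)%N -> cong s g h -> cong t g h.
Proof.
by move=> ts; apply: dvdz_trans; rewrite dvdzE /= dvdn_exp2l.
Qed.

Lemma cong0 g h : cong 0 g h.
Proof. by rewrite /cong expn0 dvd1z. Qed.

Definition cong_card (X : finType) (f : X -> int) (s : nat) (g : int) : nat :=
  #|[pred u | cong s (f u) g]|.

Lemma cong_card_eq (X : finType) (f : X -> int) s g h : cong s g h ->
  cong_card f s g = cong_card f s h.
Proof. by move=> gh; apply: eq_card => u; rewrite !inE (congr _ gh). Qed.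

Lemma cong_card_gt0 (X : finType) (f : X -> int) s u :
  (0 < cong_card f s (f u))%N.
Proof. by apply/card_gt0P; exists u; rewrite inE cong_refl. Qed.

Lemma cong_card_le (X : finType) (f : X -> int) s t g : (t <= s)%N ->
  (cong_card f s g <= cong_card f t g)%N.
Proof.
by move=> ts; apply: subset_leq_card; apply/fintype.subsetP => u; rewrite !inE;
  exact: cong_le.
Qed.

(* A depth t g at which the chain of classes of g is cut; the classes
   [{h | cong (t g) g h}] are then pairwise equal or disjoint. *)
Definition stopping (t : int -> nat) := forall g h, cong (t g) g h -> t h = t g.

Lemma stopping_common t g h l : stopping t ->
  cong (t g) l g -> cong (t h) l h -> t g = t h.
Proof.
move=> st lg lh; wlog gh : g h lg lh / (t g <= t h)%N.
  by move=> W; case: (leqP (t g) (t h)) => [|/ltnW] /W-> //.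
apply/esym/st; rewrite -(congl _ lg).
exact: cong_le gh lh.
Qed.

Variables (R : realFieldType) (X : finType) (f1 f2 : X -> int).

(** Double counting: each [v] matched to the class of [u] receives the reciprocal of its size in
    [f1]. All [u] matched to a given [v] lie in one class, so [v] receives at most 1 in total. *)
Lemma stopping_ratio_sum (t : int -> nat) (P Q : pred X) : stopping t ->
  (forall u v, P u -> cong (t (f1 u)) (f2 v) (f1 u) -> Q v) ->
  \sum_(u | P u) (cong_card f2 (t (f1 u)) (f1 u))%:R /
     (cong_card f1 (t (f1 u)) (f1 u))%:R <= #|Q|%:R :> R.
Proof.
move=> st PQ.
pose c u v : R := (cong (t (f1 u)) (f2 v) (f1 u))%:R /
  (cong_card f1 (t (f1 u)) (f1 u))%:R.
apply: (@le_trans _ _ (\sum_(u | P u) \sum_(v | Q v) c u v)).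
  apply: ler_sum => u Pu; rewrite -mulr_suml ler_wpM2r ?invr_ge0 ?ler0n //.
  rewrite -natr_sum ler_nat /cong_card -sum1_card big_mkcond/= [leqRHS]big_mkcond.
  apply: leq_sum => v _; rewrite inE; case: ifP => // /(PQ _ _ Pu) ->.
  by [].
rewrite exchange_big/= -sum1_card natr_sum; apply: ler_sum => v Qv.
case: (pickP [pred u | P u && cong (t (f1 u)) (f2 v) (f1 u)]) => [u0 /= /andP[_ h0]|no];
  last first.
  rewrite big1 // => u Pu; have /= := no u; rewrite Pu /= /c => ->.
  by rewrite mul0r.
set m := (cong_card f1 (t (f1 u0)) (f1 u0)).
apply: (@le_trans _ _ (\sum_(u | cong (t (f1 u0)) (f1 u) (f1 u0)) m%:R^-1)).
  rewrite big_mkcond [leRHS]big_mkcond; apply: ler_sum => u _.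
  case: (boolP (cong (t (f1 u)) (f2 v) (f1 u))) => huv; last first.
    by rewrite /c (negbTE huv) mul0r; do 2 case: ifP => _; rewrite ?invr_ge0 ?ler0n.
  have tt := stopping_common st huv h0.
  have uu0 : cong (t (f1 u0)) (f1 u) (f1 u0).
    by rewrite -(congl _ (_ : cong _ (f2 v) _)) // -tt.
  rewrite uu0 /c huv tt (cong_card_eq _ uu0) mul1r -/m.
  by case: ifP => _; rewrite ?invr_ge0 ?ler0n.
rewrite sumr_const -[_ *+ _]mulr_natr mulVf // pnatr_eq0 -lt0n.
exact: cong_card_gt0.
Qed.

(** [b / (a + b)] is a concave function of [b / a]; its tangent at the ratio [#|Q| / #|P|] reduces
    the claim to [stopping_ratio_sum]. *)
Lemma stopping_harmonic_sum (t : int -> nat) (P Q : pred X) : stopping t ->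
  (forall u v, P u -> cong (t (f1 u)) (f2 v) (f1 u) -> Q v) ->
  \sum_(u | P u) (cong_card f2 (t (f1 u)) (f1 u))%:R /
     ((cong_card f1 (t (f1 u)) (f1 u))%:R + (cong_card f2 (t (f1 u)) (f1 u))%:R)
   <= #|P|%:R * #|Q|%:R / (#|P|%:R + #|Q|%:R) :> R.
Proof.
move=> st PQ; have := stopping_ratio_sum st PQ.
case: (posnP #|P|) => [P0 _|P0].
  by rewrite P0 !mul0r big1 // => u Pu; have := card0_eq P0 u; rewrite unfold_in Pu.
set A : R := #|P|%:R; set B : R := #|Q|%:R => rs.
have A0 : 0 < A by rewrite ltr0n.
have B0 : 0 <= B by rewrite ler0n.
have AB : 0 < A + B by lra.
apply: (@le_trans _ _ (\sum_(u | P u) ((B / (A + B)) ^+ 2 +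
    (A / (A + B)) ^+ 2 * ((cong_card f2 (t (f1 u)) (f1 u))%:R /
     (cong_card f1 (t (f1 u)) (f1 u))%:R)))).
  apply: ler_sum => u Pu.
  have : 0 < (cong_card f1 (t (f1 u)) (f1 u))%:R :> R by rewrite ltr0n cong_card_gt0.
  have : 0 <= (cong_card f2 (t (f1 u)) (f1 u))%:R :> R by rewrite ler0n.
  move: (_%:R) => b; move: (_%:R) => a b0 a0.
  have ab : 0 < a + b by lra.
  rewrite -subr_ge0.
  have -> : (B / (A + B)) ^+ 2 + (A / (A + B)) ^+ 2 * (b / a) - b / (a + b) =
     (A * b - a * B) ^+ 2 / ((A + B) ^+ 2 * a * (a + b)).
    by field; rewrite !gt_eqF.
  by rewrite divr_ge0 ?sqr_ge0 // !mulr_ge0 ?sqr_ge0 // ltW.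
rewrite big_split/= sumr_const -[_ *+ #|_|]mulr_natr -/A -mulr_sumr.
apply: (@le_trans _ _ ((B / (A + B)) ^+ 2 * A + (A / (A + B)) ^+ 2 * B)).
  by rewrite lerD2l ler_wpM2l // sqr_ge0.
rewrite le_eqVlt; apply/orP; left; apply/eqP.
by field; rewrite gt_eqF.
Qed.

(** [A * B / (A + B)] is superadditive. The exact defect has denominator
    [(A + B) * (a + b) * ((A - a) + (B - b))], whose last two factors are at most [A + B]. *)
Lemma harmonic_split (A B a b : R) : 0 < A -> 0 < B -> 0 <= a <= A -> 0 <= b <= B ->
  a * b / (a + b) + (A - a) * (B - b) / ((A - a) + (B - b)) <=
  A * B / (A + B) - (a * B - b * A) ^+ 2 / (A + B) ^+ 3.
Proof.
move=> A0 B0 /andP[a0 aA] /andP[b0 bB].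
have AB : 0 < A + B by lra.
case: (eqVneq (a + b) 0) => [ab0|ab0].
  have -> : a = 0 by lra.
  have -> : b = 0 by lra.
  by rewrite !mul0r !subr0 !add0r expr2 !mul0r subr0.
case: (eqVneq ((A - a) + (B - b)) 0) => [ab1|ab1].
  have -> : a = A by lra.
  have -> : b = B by lra.
  by rewrite !(mul0r, subrr, addr0, subr0, invr0, mulr0) [B * A]mulrC subrr expr0n mul0r
    subr0.
have ab : 0 < a + b by rewrite lt0r ab0; lra.
have ab' : 0 < (A - a) + (B - b) by rewrite lt0r ab1; lra.
have -> : a * b / (a + b) + (A - a) * (B - b) / ((A - a) + (B - b)) =
  A * B / (A + B) - (a * B - b * A) ^+ 2 / ((A + B) * ((a + b) * ((A - a) + (B - b)))).
  by field; rewrite !gt_eqF.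
rewrite lerD2l lerN2 ler_wpM2l ?sqr_ge0 // lef_pV2 ?posrE ?exprn_gt0 ?mulr_gt0 //.
rewrite exprS ler_pM2l // expr2 ler_pM //; lra.
Qed.

(** The matching respects the splittings by [Ue] and [Ve], so the harmonic bound applies to each
    half; the quadratic term measures how far the two relative sizes disagree. *)
Lemma stopping_split_sum (t : int -> nat) (U V Ue Ve : pred X) : stopping t ->
  (0 < #|U|)%N -> (0 < #|V|)%N -> {subset Ue <= U} -> {subset Ve <= V} ->
  (forall u v, U u -> cong (t (f1 u)) (f2 v) (f1 u) -> V v /\ Ue u = Ve v) ->
  \sum_(u | U u) (cong_card f2 (t (f1 u)) (f1 u))%:R /
     ((cong_card f1 (t (f1 u)) (f1 u))%:R + (cong_card f2 (t (f1 u)) (f1 u))%:R)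
   <= #|U|%:R * #|V|%:R / (#|U|%:R + #|V|%:R)
   - (#|Ue|%:R * #|V|%:R - #|Ve|%:R * #|U|%:R) ^+ 2 / (#|U|%:R + #|V|%:R) ^+ 3 :> R.
Proof.
move=> st U0 V0 sU sV h.
have cD (P Q : pred X) : {subset Q <= P} ->
  #|[pred u | P u && ~~ Q u]|%:R = #|P|%:R - #|Q|%:R :> R.
  move=> sQ; rewrite -natrB; last by apply: subset_leq_card; apply/fintype.subsetP.
  congr _%:R; rewrite -(cardID Q P) [X in (X + _)%N](_ : _ = #|Q|).
    rewrite addKn; apply: eq_card => u; rewrite !inE andbC //.
  apply: eq_card => u; rewrite !inE; apply: andb_idl; exact: sQ.
rewrite (bigID Ue)/=.
apply: le_trans (harmonic_split _ _ _ _); rewrite ?ltr0n //; last 2 first.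
- by rewrite ler0n ler_nat; apply: subset_leq_card; apply/fintype.subsetP.
- by rewrite ler0n ler_nat; apply: subset_leq_card; apply/fintype.subsetP.
rewrite -!cD //; apply: lerD; last first.
  apply: stopping_harmonic_sum => // u v /andP[Uu nU] /(h _ _ Uu) [/= -> <-] //.
rewrite (_ : #|Ue| = #|[pred u | U u && Ue u]|); last first.
  by apply: eq_card => u; rewrite !inE; apply/esym/andb_idl/sU.
apply: stopping_harmonic_sum => // u v /andP[Uu +] /(h _ _ Uu) [_ <-] //.
Qed.

End Congruence.

Section Update.
Variables (k : nat) (X : finType).
Implicit Types (x : {ffun 'I_k -> X}) (i : 'I_k).

Definition upd x i (y : X) : {ffun 'I_k -> X} := [ffun j => if j == i then y else x j].

Lemma updE x i y j : upd x i y j = if j == i then y else x j.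
Proof. by rewrite ffunE. Qed.

Lemma upd_upd x i y y' : upd (upd x i y) i y' = upd x i y'.
Proof. by apply/ffunP => j; rewrite !ffunE; case: eqP. Qed.

Lemma upd_id x i : upd x i (x i) = x.
Proof. by apply/ffunP => j; rewrite !ffunE; case: eqP => [->|]. Qed.

Lemma sum_upd (V : nmodType) i (F : {ffun 'I_k -> X} -> X -> V) :
  \sum_x \sum_y F x y = \sum_x \sum_y F (upd x i y) (x i).
Proof.
rewrite !pair_bigA/= (reindex_inj (h := fun q => (upd q.1 i q.2, q.1 i)))//=.
apply: (can_inj (g := fun q => (upd q.1 i q.2, q.1 i))) => -[x y]/=.
by rewrite upd_upd upd_id updE eqxx.
Qed.

End Update.

(** * Cutting the tree of residue classes *)

Section Tree.
Variables (p k : nat) (X : finType) (z : 'I_k -> X -> int) (d K : nat).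
Hypotheses (d1 : (1 < d)%N) (zK : forall i x y, cong p K (z i x) (z i y) -> x = y).
Let n := #|X|.
Implicit Types (x : {ffun 'I_k -> X}) (i l : 'I_k) (G H : 'I_k -> int).

Definition cnt i s g := cong_card p (z i) s g.

(* tau r G is the first level at which the class of some coordinate of G has
   fewer than n / d^r elements. *)
Definition light r G s := [exists i, cnt i s (G i) * d ^ r < n]%N.

Definition tau r G := find (light r G) (iota 0 K.+1).

Lemma tau_before r G s : (s < tau r G)%N -> ~~ light r G s.
Proof.
move=> st; have := before_find 0 st; rewrite nth_iota ?add0n => [->//|].
by apply: leq_trans st _; rewrite -[leqRHS](size_iota 0); exact: find_size.
Qed.

Lemma tau_le r G : (tau r G <= K.+1)%N.
Proof. by rewrite -[leqRHS](size_iota 0); exact: find_size. Qed.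

(** [K.+1] is the value of [find] when no level up to [K] is light. *)
Lemma tau_eq r G t : (forall s, (s < t)%N -> ~~ light r G s) ->
  (light r G t \/ t = K.+1) -> (t <= K.+1)%N -> tau r G = t.
Proof.
move=> ht h tK; apply/eqP; rewrite eqn_leq; apply/andP; split; last first.
  rewrite leqNgt; apply/negP => lt.
  have := ht _ lt; rewrite /tau in lt *.
  have hs : has (light r G) (iota 0 K.+1).
    by rewrite has_find size_iota (leq_trans lt tK).
  have := nth_find 0 hs; rewrite nth_iota ?add0n => [->//|].
  by rewrite (leq_trans lt tK).
case: h => [lt|->]; last exact: tau_le.
rewrite leqNgt; apply/negP => /tau_before; by rewrite lt.
Qed.

Lemma tau_light r G : (0 < k)%N -> (d ^ r < n)%N ->
  (tau r G <= K)%N /\ light r G (tau r G).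
Proof.
move=> k0 dn.
have hs : has (light r G) (iota 0 K.+1).
  (* By [zK] a class at depth [K] has at most one element, hence is light. *)
  apply/hasP; exists K; first by rewrite mem_iota add0n ltnSn.
  apply/existsP; exists (Ordinal k0).
  apply: leq_ltn_trans dn; rewrite -[leqRHS]mul1n leq_mul2r; apply/orP; right.
  apply/card_le1_eqP => u v; rewrite !inE => hu hv; apply: (@zK (Ordinal k0)).
  by apply: cong_trans hv _; rewrite cong_sym.
have tK : (tau r G < K.+1)%N by rewrite -[ltnRHS](size_iota 0) -has_find.
by split=> //; have := nth_find 0 hs; rewrite nth_iota.
Qed.

Lemma light_eq r G H s : (forall i, cong p s (G i) (H i)) -> light r G s = light r H s.
Proof. by move=> GH; apply: eq_existsb => i; rewrite /cnt (cong_card_eq _ (GH i)). Qed.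

Lemma tau_ext r G H : (forall i, cong p (tau r G) (G i) (H i)) -> tau r H = tau r G.
Proof.
move=> GH; apply: tau_eq; last exact: tau_le.
  move=> s st; rewrite -(@light_eq _ G); first exact: tau_before.
  by move=> i; apply: cong_le (GH i); exact: ltnW.
case: (ltnP (tau r G) K.+1) => h; last by right; apply/eqP; rewrite eqn_leq tau_le.
left; rewrite -(@light_eq _ G) //.
have hs : has (light r G) (iota 0 K.+1) by rewrite has_find size_iota.
by have := nth_find 0 hs; rewrite nth_iota ?add0n.
Qed.

Lemma tau_gt r G H D : (forall i, cong p D (G i) (H i)) -> (D < tau r G)%N ->
  (D < tau r H)%N.
Proof.
move=> GH DG; rewrite ltnNge; apply/negP => HD.
have := @tau_ext r H G; rewrite {1}/tau => E.
move: (DG); rewrite E ?ltnNge ?HD // => i.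
by rewrite cong_sym; exact: cong_le (GH i).
Qed.

Lemma tau_mono r r' G : (r <= r')%N -> (tau r G <= tau r' G)%N.
Proof.
move=> rr; rewrite leqNgt; apply/negP => lt.
have := tau_before lt; case/negP.
have hs : has (light r' G) (iota 0 K.+1).
  by rewrite has_find size_iota (leq_trans lt (tau_le _ _)).
have := nth_find 0 hs; rewrite -/(tau r' G) nth_iota ?add0n; last first.
  exact: leq_trans lt (tau_le _ _).
case/existsP => i hi; apply/existsP; exists i; apply: leq_ltn_trans hi.
by rewrite leq_mul2l leq_exp2l // rr orbT.
Qed.

(* The coordinate l of a zero-sum tuple is determined by the others; Gv records
   the residues it must have, whether or not an element of X realises them. *)
Definition Gv l x : 'I_k -> int :=
  fun j => if j == l then - \sum_(i | i != l) z i (x i) else z j (x j).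

(** The line through [x] in direction [i]: coordinate [i] takes any integer value, attained or not,
    and coordinate [l] compensates. *)
Definition vec l i x (g : int) : 'I_k -> int :=
  fun j => if j == l then - (g + \sum_(m | (m != l) && (m != i)) z m (x m))
           else if j == i then g else z j (x j).

Lemma Gv_upd l i x u : i != l -> Gv l (upd x i u) =1 vec l i x (z i u).
Proof.
move=> il j; rewrite /Gv /vec; case: eqP => // _.
  rewrite (bigD1 i)//= updE eqxx; congr (- (_ + _)); apply: eq_bigr => m /andP[_ mi].
  by rewrite updE (negbTE mi).
by rewrite updE; case: eqP => [->|].
Qed.

Lemma Gv_vec l i x : i != l -> Gv l x =1 vec l i x (z i (x i)).
Proof. by move=> il j; rewrite -{1}(upd_id x i) Gv_upd. Qed.

Lemma Gv_updl l x u : Gv l (upd x l u) =1 Gv l x.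
Proof.
move=> j; rewrite /Gv; case: eqP => [_|/eqP jl]; last by rewrite updE (negbTE jl).
by congr (- _); apply: eq_bigr => i il; rewrite updE (negbTE il).
Qed.

Lemma vec_cong l i x g h s j : cong p s g h -> cong p s (vec l i x g j) (vec l i x h j).
Proof.
move=> gh; rewrite /vec; case: eqP => _; last by case: eqP => // _; exact: cong_refl.
by rewrite /cong -opprD rpredN opprD addrACA subrr addr0.
Qed.

Lemma eq_tau r G H : G =1 H -> tau r G = tau r H.
Proof. by move=> GH; apply/esym/tau_ext => i; rewrite GH cong_refl. Qed.

Lemma tau_vec_stopping r l i x : stopping p (fun g => tau r (vec l i x g)).
Proof. by move=> g h gh; apply: tau_ext => j; exact: vec_cong. Qed.

(** The value coordinate [i] needs for a zero sum when coordinate [l] is [v]. Classes of [l] thereby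
    become classes on the axis of [i], where the sums over stopping depths apply. *)
Definition partner l i x (v : X) : int :=
  - (z l v + \sum_(m | (m != l) && (m != i)) z m (x m)).

Lemma partnerE l i x v s g :
  cong p s (partner l i x v) g = cong p s (z l v) (vec l i x g l).
Proof.
rewrite /partner /vec eqxx /cong; set Y := \sum_(_ | _) _.
by rewrite (_ : - (z l v + Y) - g = - (z l v - - (g + Y))) ?rpredN //; ring.
Qed.

Lemma cong_card_partner l i x s g :
  cong_card p (partner l i x) s g = cnt l s (vec l i x g l).
Proof. by apply: eq_card => v; rewrite !inE partnerE. Qed.

Lemma vec_i l i x g : i != l -> vec l i x g i = g.
Proof. by move=> /negbTE il; rewrite /vec il eqxx. Qed.

Lemma Gv_upd_cong l i x u s : i != l -> cong p s (z i u) (z i (x i)) ->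
  forall j, cong p s (Gv l (upd x i u) j) (Gv l x j).
Proof. by move=> il h j; rewrite (Gv_upd x u il) (Gv_vec x il); exact: vec_cong. Qed.

Lemma tau_upd r l i x u : i != l -> cong p (tau r (Gv l x)) (z i u) (z i (x i)) ->
  tau r (Gv l (upd x i u)) = tau r (Gv l x).
Proof. by move=> il h; apply: tau_ext => j; rewrite cong_sym; exact: Gv_upd_cong. Qed.

Lemma tau_upd_sym r l i x u : i != l ->
  cong p (tau r (Gv l (upd x i u))) (z i (x i)) (z i u) =
  cong p (tau r (Gv l x)) (z i u) (z i (x i)).
Proof.
move=> il; apply/idP/idP => h; last by rewrite tau_upd // cong_sym.
have := @tau_upd r l i (upd x i u) (x i) il.
by rewrite upd_upd upd_id updE eqxx => /(_ h) ->; rewrite cong_sym.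
Qed.

Lemma sol_Gv l x : \sum_i z i (x i) = 0 -> Gv l x =1 fun i => z i (x i).
Proof.
move=> s0 j; rewrite /Gv; case: eqP => // ->; apply/esym/eqP.
by rewrite -addr_eq0 -(bigD1 l (P := predT)) //= s0.
Qed.

(** Overwriting coordinate [l] of a solution by any of the [n] elements leaves [Gv] unchanged, and
    the solution can be recovered from its other coordinates. Bounds for free tuples thus gain a
    factor [n] on solutions. *)
Lemma card_sol_le l (P : ('I_k -> int) -> bool) : (forall G H, G =1 H -> P G = P H) ->
  injective (z l) ->
  (#|[pred x : {ffun 'I_k -> X} | (\sum_i z i (x i) == 0)%R && P (fun i => z i (x i))]|
    * n <=
   #|[pred x | P (Gv l x)]|)%N.
Proof.
move=> eP zl; rewrite /n -cardX; set A := [predX _ & _].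
rewrite -(card_in_imset (f := fun q => upd q.1 l q.2) (D := A)).
  apply: subset_leq_card; apply/fintype.subsetP => _ /imsetP[[x y] + ->];
    rewrite !inE /= andbT.
  move=> /andP[/eqP s0 Px]; rewrite (eP _ _ (@Gv_updl l x y)).
  by rewrite (eP _ _ (@sol_Gv l x s0)).
move=> [x y] [x' y']; rewrite !inE/= !andbT => /andP[/eqP s0 _] /andP[/eqP s0' _] E.
have Ej j : j != l -> x j = x' j.
  by move=> /negbTE jl; have /ffunP/(_ j) := E; rewrite !updE jl.
have -> : y = y' by have /ffunP/(_ l) := E; rewrite !updE eqxx.
congr pair; apply/ffunP => j; case: (eqVneq j l) => [->|]; last exact: Ej.
apply: zl.
have : \sum_i z i (x i) = \sum_i z i (x' i) by rewrite s0 s0'.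
rewrite (bigD1 l)//= [RHS](bigD1 l)//=.
rewrite (eq_bigr (fun i => z i (x' i))) => [/addIr//|i il].
by rewrite Ej.
Qed.

End Tree.

(** * The potential *)

Section Potential.
Variables (R : realFieldType).
Variables (p k : nat) (X : finType) (z : 'I_k -> X -> int) (d K : nat).
Hypothesis d1 : (1 < d)%N.
Local Notation n := #|X|.
Local Notation cnt := (cnt p z).
Local Notation tau := (tau p z d K).
Local Notation Gv := (Gv z).
Local Notation vec := (vec z).
Implicit Types (x : {ffun 'I_k -> X}) (i l : 'I_k) (G H : 'I_k -> int).

Lemma sum_upd_le i (h : {ffun 'I_k -> X} -> R) (c : R) :
  (forall x, \sum_u h (upd x i u) <= c) -> n%:R * \sum_x h x <= n%:R ^+ k * c.
Proof.
move=> hc; have -> : n%:R * \sum_x h x = \sum_x \sum_(u : X) h (upd x i u).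
  rewrite -(sum_upd i (fun x u => h x)) mulr_sumr; apply: eq_bigr => x _.
  by rewrite /= sumr_const mulr_natl.
apply: le_trans (ler_sum _ (fun x _ => hc x)) _.
by rewrite sumr_const card_ffun card_ord -natrX mulr_natl.
Qed.

Lemma sum_pred (T : finType) (P : pred T) : \sum_x ((P x)%:R : R) = #|P|%:R.
Proof.
by rewrite -natr_sum -sum1_card [in RHS]big_mkcond; congr _%:R.
Qed.

Lemma card_upd_le i (P : pred {ffun 'I_k -> X}) (e : nat) : (0 < e)%N ->
  (forall x, #|[pred u | P (upd x i u)]| * e <= n)%N -> (#|P| * e <= n ^ k)%N.
Proof.
move=> e0 hP; case: (posnP n) => [n0|n0].
  rewrite eq_card0 // => x; have := card0_eq n0 (x i).
  by rewrite !inE.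
suff : n%:R * \sum_x ((P x)%:R : R) <= n%:R ^+ k * (n%:R / e%:R).
  rewrite mulrA [X in _ <= X / _]mulrC -mulrA ler_pM2l ?ltr0n // ler_pdivlMr ?ltr0n //.
  by rewrite sum_pred -natrM -natrX ler_nat.
apply: (@sum_upd_le i) => x.
by rewrite (sum_pred (fun u => P (upd x i u))) ler_pdivlMr ?ltr0n // -natrM ler_nat hP.
Qed.

(** On each line in direction [i] the ratios of the class sizes of [l] to those of [i] sum to at
    most [n], and an unbalanced tuple contributes more than [d]. *)
Lemma card_unbalanced r i l : i != l ->
  (#|[pred x | cnt i (tau r (Gv l x)) (Gv l x i) * d <
               cnt l (tau r (Gv l x)) (Gv l x l)]| * d <= n ^ k)%N.
Proof.
move=> il; have d0 : (0 < d)%N by apply: ltn_trans d1.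
apply: (card_upd_le (i := i) d0) => x.
pose t g := tau r (vec l i x g).
pose Q := [pred u | (cnt i (t (z i u)) (z i u) * d < cnt l (t (z i u))
  (vec l i x (z i u) l))%N].
rewrite (@eq_card _ _ Q); last first.
  by move=> u; rewrite !inE (eq_tau _ _ _ _ _ (Gv_upd _ _ _ il)) !Gv_upd // vec_i.
have := @stopping_ratio_sum p R X (z i) (partner z l i x) t Q predT
  (@tau_vec_stopping p k X z d K r l i x) (fun _ _ _ _ => isT).
move=> rs; rewrite -(ler_nat R) natrM -sum_pred mulr_suml; apply: le_trans rs.
rewrite [leRHS]big_mkcond; apply: ler_sum => u _.
case: (boolP (Q u)) => [/= Qu|_]; last by rewrite mul0r.
rewrite mul1r ler_pdivlMr ?ltr0n ?cong_card_gt0 // -natrM ler_nat mulnC.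
by rewrite cong_card_partner; exact: ltnW.
Qed.

(* Each block of the partition cut out by tau carries total weight one in
   every direction i. *)
Lemma sum_block_average r i l (h : {ffun 'I_k -> X} -> R) : i != l ->
  \sum_x (\sum_(u | cong p (tau r (Gv l x)) (z i u) (z i (x i))) h (upd x i u)) /
     (cnt i (tau r (Gv l x)) (z i (x i)))%:R = \sum_x h x.
Proof.
move=> il.
pose F x u : R := if cong p (tau r (Gv l x)) (z i u) (z i (x i))
   then h (upd x i u) / (cnt i (tau r (Gv l x)) (z i (x i)))%:R else 0.
transitivity (\sum_x \sum_u F x u).
  by apply: eq_bigr => x _; rewrite mulr_suml big_mkcond.
rewrite (sum_upd i); apply: eq_bigr => x _.
rewrite (eq_bigr (fun u => if cong p (tau r (Gv l x)) (z i u) (z i (x i))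
    then h x / (cnt i (tau r (Gv l x)) (z i (x i)))%:R else 0)); last first.
  move=> u _; rewrite /F updE eqxx upd_upd upd_id (tau_upd_sym _ _ _ _ _ _ _ il).
  case: ifP => // h1; rewrite (tau_upd il) //.
  by rewrite /cnt (cong_card_eq _ h1).
rewrite -big_mkcond sumr_const -[_ *+ _]mulr_natr -mulrA mulVf ?mulr1 //.
by rewrite pnatr_eq0 -lt0n cong_card_gt0.
Qed.

Definition harm r i l x : R :=
  (cnt l (tau r (Gv l x)) (Gv l x l))%:R /
  ((cnt i (tau r (Gv l x)) (Gv l x i))%:R + (cnt l (tau r (Gv l x)) (Gv l x l))%:R).

Lemma harm_ge0 r i l x : 0 <= harm r i l x.
Proof. by rewrite /harm divr_ge0 ?addr_ge0 ?ler0n. Qed.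

Lemma harm_le1 r i l x : harm r i l x <= 1.
Proof.
rewrite /harm; move: (cnt l _ _) (cnt i _ _) => b a.
case: (posnP (a + b)) => [|ab].
  by move/eqP; rewrite addn_eq0 => /andP[_ /eqP->]; rewrite mul0r.
by rewrite ler_pdivrMr -natrD ?ltr0n // mul1r ler_nat leq_addl.
Qed.

Definition potential r i l : R := \sum_x harm r i l x.

Lemma potential_ge0 r i l : 0 <= potential r i l.
Proof. by apply: sumr_ge0 => x _; exact: harm_ge0. Qed.

Lemma potential_le r i l : potential r i l <= n%:R ^+ k.
Proof.
apply: le_trans (ler_sum _ (fun x _ => harm_le1 _ _ _ x)) _.
by rewrite sumr_const card_ffun card_ord natrX.
Qed.

Definition block_size r i l x : R := (cnt i (tau r (Gv l x)) (Gv l x i))%:R.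

(* The loss of the potential between the levels r and r' inside the block of x,
   per element of the block. *)
Definition loss r r' i l x : R :=
  (block_size r i l x * block_size r l l x / (block_size r i l x + block_size r l l x)
   - \sum_(u | cong p (tau r (Gv l x)) (z i u) (z i (x i))) harm r' i l (upd x i u))
  / block_size r i l x.

Lemma block_sizeE r i l x : i != l ->
  block_size r i l x = (cnt i (tau r (Gv l x)) (z i (x i)))%:R.
Proof. by move=> il; rewrite /block_size (Gv_vec _ _ il) vec_i. Qed.

Lemma sum_loss r r' i l : i != l ->
  \sum_x loss r r' i l x = potential r i l - potential r' i l.
Proof.
move=> il; rewrite /potential -sumrB -[RHS](sum_block_average r _ il);
  apply: eq_bigr => x _.
rewrite /loss /= sumrB -(block_sizeE _ _ il); congr ((_ - _) / _).
rewrite (eq_bigr (fun=> harm r i l x)).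
  rewrite sumr_const -[_ *+ _]mulr_natl -(block_sizeE _ _ il) /harm mulrA //.
move=> u hu; rewrite /harm (tau_upd il) // /cnt.
by rewrite !(fun j => cong_card_eq _ (Gv_upd_cong il hu j)).
Qed.

Lemma harm_vec r i l x u : i != l ->
  let t := tau r (vec l i x (z i u)) in
  harm r i l (upd x i u) = (cong_card p (partner z l i x) t (z i u))%:R /
   ((cong_card p (z i) t (z i u))%:R + (cong_card p (partner z l i x) t (z i u))%:R).
Proof.
move=> il t; rewrite /harm (eq_tau _ _ _ _ _ (Gv_upd _ _ _ il)) !Gv_upd // vec_i //.
by rewrite cong_card_partner.
Qed.

Lemma card_block r i l x : i != l ->
  #|[pred u | cong p (tau r (Gv l x)) (z i u) (z i (x i))]|%:R = block_size r i l x.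
Proof. by move=> il; rewrite block_sizeE. Qed.

Lemma card_partner_block r i l x : i != l ->
  #|[pred v | cong p (tau r (Gv l x)) (partner z l i x v) (z i (x i))]|%:R =
    block_size r l l x.
Proof.
by move=> il; rewrite /block_size (Gv_vec z x il) -cong_card_partner.
Qed.

Lemma tau_vec_ge r r' i l x g : (r <= r')%N -> i != l ->
  cong p (tau r (Gv l x)) g (z i (x i)) -> (tau r (Gv l x) <= tau r' (vec l i x g))%N.
Proof.
move=> rr il hg; apply: leq_trans _ (tau_mono p z K d1 _ rr).
rewrite (@tau_ext p k X z d K r (Gv l x)) // => j.
by rewrite (Gv_vec _ _ il) vec_cong // cong_sym.
Qed.

Lemma loss_ge0 r r' i l x : (r <= r')%N -> i != l -> 0 <= loss r r' i l x.
Proof.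
move=> rr il; rewrite /loss divr_ge0 ?ler0n // subr_ge0.
rewrite -(card_block _ _ il) -(card_partner_block _ _ il).
rewrite (eq_bigr _ (fun u _ => harm_vec _ _ _ il)).
apply: (stopping_harmonic_sum _ (@tau_vec_stopping p k X z d K r' l i x)) => u v hu huv.
apply: cong_trans (hu); apply: cong_le huv; exact: tau_vec_ge.
Qed.

(** Splits the block by the class of [g] at depth [D.+1]. The cuts at [r'] respect this: a class cut
    at depth at most [D] cannot contain [g], for it would then contain [z i (x i)], whose cut lies
    deeper. *)
Lemma loss_lower r r' i l x D g : (r <= r')%N -> i != l ->
  (tau r (Gv l x) <= D < tau r' (Gv l x))%N -> cong p D g (z i (x i)) ->
  0 < block_size r l l x ->
  let A := block_size r i l x in let B := block_size r l l x in
  let a := (cnt i D.+1 g)%:R in let b := (cnt l D.+1 (vec l i x g l))%:R in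
  (a * B - b * A) ^+ 2 / (A + B) ^+ 3 / A <= loss r r' i l x.
Proof.
move=> rr il /andP[sD Ds] hg B0; set A := block_size r i l x; set B := block_size r l l x.
set a := (_)%:R; set b := (_)%:R.
rewrite /loss ler_wpM2r ?invr_ge0 ?ler0n // -/A -/B lerBrDr addrC -lerBrDr.
pose t g := tau r' (vec l i x g).
have st : stopping p t := @tau_vec_stopping p k X z d K r' l i x.
pose U := [pred u | cong p (tau r (Gv l x)) (z i u) (z i (x i))].
pose V := [pred v | cong p (tau r (Gv l x)) (partner z l i x v) (z i (x i))].
pose Ue := [pred u | cong p D.+1 (z i u) g].
pose Ve := [pred v | cong p D.+1 (partner z l i x v) g].
have tx : t (z i (x i)) = tau r' (Gv l x) by apply/esym/eq_tau/Gv_vec.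
have cU : #|U|%:R = A by rewrite /U card_block.
have cV : #|V|%:R = B by rewrite /V card_partner_block.
have cUe : #|Ue|%:R = a by [].
have cVe : #|Ve|%:R = b by rewrite /b -cong_card_partner.
rewrite -cU -cV -cUe -cVe (eq_bigr _ (fun u _ => harm_vec _ _ _ il)).
have hg' : cong p (tau r (Gv l x)) g (z i (x i)) by apply: cong_le hg.
apply: (stopping_split_sum _ st (U := U)).
- by rewrite -(ltr_nat R) cU /A block_sizeE // ltr0n cong_card_gt0.
- by rewrite -(ltr_nat R) cV.
- by move=> u; rewrite !inE => hu; apply: cong_trans hg'; apply: cong_le hu; exact: leqW.
- by move=> u; rewrite !inE => hu; apply: cong_trans hg'; apply: cong_le hu; exact: leqW.
move=> u v /= hu huv; split.
  by apply: cong_trans (hu); apply: cong_le huv; exact: tau_vec_ge.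
case: (ltnP D (t (z i u))) => ht.
  by rewrite (congl _ (cong_le ht huv)).
have no : ~~ cong p (t (z i u)) (z i u) g.
  apply/negP => h; move: (Ds); rewrite -tx (st (z i u)) ?ltnNge ?ht //.
  by apply: cong_trans h _; apply: cong_le hg.
have tD : (t (z i u) <= D.+1)%N by apply: leqW.
apply/idP/idP => h; case/negP: no; first exact: cong_le h.
by rewrite -(congl _ huv); apply: cong_le h.
Qed.

End Potential.

Lemma cong_progression p D (g H : int) (j j' : nat) : prime p -> cong p D H 0 ->
  ~~ cong p D.+1 H 0 ->
  (j < p)%N -> (j' < p)%N -> cong p D.+1 (g + H * j%:Z) (g + H * j'%:Z) -> j = j'.
Proof.
move=> pp; rewrite /cong !subr0 !dvdzE/= => /dvdnP[h Hh] nH jp j'p.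
have -> : g + H * j%:Z - (g + H * j'%:Z) = H * (j%:Z - j'%:Z) by ring.
rewrite abszM Hh expnS mulnAC dvdn_pmul2r ?expn_gt0 ?prime_gt0 // Euclid_dvdM //.
case/orP => [ph|].
  by move: nH; rewrite Hh expnS dvdn_pmul2r ?ph // expn_gt0 prime_gt0.
move=> /dvdn_leq; case: (posnP `|j%:Z - j'%:Z|%N) => [|h0 /(_ isT)]; lia.
Qed.

(** The terms of the progression are distinct modulo [p ^ D.+1], so their classes are disjoint parts
    of the class of [f x] at depth [s]. *)
Lemma cong_card_progression p D s (X : finType) (f : X -> int) (x : X) (H : int)
  (M : nat) :
  prime p -> cong p D H 0 -> ~~ cong p D.+1 H 0 -> (M <= p)%N -> (s <= D)%N ->
  (\sum_(j < M) cong_card p f D.+1 (f x + H * (j : nat)%:Z) <= cong_card p f s (f x))%N.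
Proof.
move=> pp HD nHD Mp sD; rewrite /cong_card.
under eq_bigr do rewrite -sum1_card big_mkcond.
rewrite exchange_big -sum1_card [leqRHS]big_mkcond; apply: leq_sum => u _ /=.
rewrite inE; case: (pickP [pred j : 'I_M | cong p D.+1 (f u) (f x + H * (j : nat)%:Z)]) =>
  [j0 /= h0|no]; last first.
  by rewrite big1 // => j _; have /= := no j; rewrite inE => ->.
have -> : cong p s (f u) (f x).
  have /(cong_trans (cong_le (leqW sD) h0)) : cong p s (f x + H * (j0 : nat)%:Z) (f x).
    apply: cong_le sD _; move: HD; rewrite /cong subr0 addrAC subrr add0r => HD.
    exact: dvdz_mulr.
  by [].
rewrite (bigD1 j0)//= inE h0 big1 // => j jj0; rewrite inE; case: ifP => // hj.
case/eqP: jj0; apply/val_inj/(@cong_progression p D (f x) H) => //.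
- exact: leq_trans (ltn_ord _) Mp.
- exact: leq_trans (ltn_ord _) Mp.
by rewrite -(congl _ hj).
Qed.

(** Turns a small loss in [loss_lower] into closeness of the relative sizes of two matched
    subclasses. *)
Lemma balance_close (R : realFieldType) (A B a b rho lam : R) : 0 < A -> 0 < B ->
  0 < rho ->
  A <= rho * B -> B <= rho * A -> 0 <= lam ->
  (a * B - b * A) ^+ 2 / (A + B) ^+ 3 / A < lam ^+ 2 / (rho ^+ 2 * (1 + rho) ^+ 3) ->
  `|a / A - b / B| < lam.
Proof.
move=> A0 B0 r0 AB BA l0 h.
rewrite -(@ltr_pXn2r _ 2) ?nnegrE ?normr_ge0 // real_normK ?num_real //.
set e := a / A - b / B.
have E : a * B - b * A = A * B * e by rewrite /e; field; rewrite !gt_eqF.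
have AB0 : 0 < A + B by lra.
have r1 : 0 < rho ^+ 2 * (1 + rho) ^+ 3 by rewrite mulr_gt0 ?exprn_gt0 //; lra.
rewrite ltr_pdivlMr // in h; apply: le_lt_trans h.
rewrite E.
have -> : (A * B * e) ^+ 2 / (A + B) ^+ 3 / A * (rho ^+ 2 * (1 + rho) ^+ 3) =
   e ^+ 2 * (A * (rho * B) ^+ 2 * (1 + rho) ^+ 3 / (A + B) ^+ 3).
  by field; rewrite !gt_eqF.
rewrite -[leLHS]mulr1 ler_wpM2l ?sqr_ge0 // ler_pdivlMr ?exprn_gt0 // mul1r.
apply: (@le_trans _ _ (((1 + rho) * A) ^+ 3)).
  have AB' : A + B <= (1 + rho) * A by rewrite mulrDl mul1r lerD2l.
  by rewrite ler_pXn2r // nnegrE; [exact: ltW | apply: le_trans AB'; exact: ltW].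
rewrite exprMn mulrC ler_wpM2r ?exprn_ge0 //; first lra.
rewrite exprS ler_pM2l // ler_pXn2r ?nnegrE //; try exact: ltW.
by rewrite mulr_ge0 // ltW.
Qed.

(* Two sequences of nonnegative numbers that nearly agree both in phase and
   shifted by one are nearly constant, so their total is large. *)
Lemma chained_sum_gt1 (R : realFieldType) (M : nat) (kap lam : R) (a b : nat -> R) :
  0 < lam -> kap <= a 0%N -> 2 * M%:R * lam <= kap / 2 -> 2 < M%:R * kap ->
  (forall j, (j < M)%N -> `|a j - b j| < lam) ->
  (forall j, (j < M)%N -> `|a j - b j.+1| < lam) ->
  1 < \sum_(j < M) a j.
Proof.
move=> l0 a0 hl hM h1 h2.
have ha j : (j < M)%N -> kap - 2 * j%:R * lam <= a j.
  elim: j => [_|j IH jM]; first by rewrite mulr0 mul0r subr0.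
  have := IH (ltnW jM); have := h2 j (ltnW jM); have := h1 j.+1 jM.
  by rewrite !ltr_norml -natr1 => /andP[? ?] /andP[? ?] ?; lra.
apply: (@lt_le_trans _ _ (\sum_(j < M) (kap / 2))).
  by rewrite sumr_const card_ord -mulr_natl; lra.
apply: ler_sum => j _; apply: le_trans (ha _ (ltn_ord j)).
have : 2 * (j : nat)%:R * lam <= 2 * M%:R * lam.
  by rewrite ler_wpM2r ?(ltW l0) // ler_wpM2l // ler_nat ltnW.
lra.
Qed.

(** * Misaligned solutions are rare *)

Section Dichotomy.
Variables (R : realFieldType).
Variables (p k : nat) (X : finType) (z : 'I_k -> X -> int) (d K : nat).
Hypothesis d1 : (1 < d)%N.
Local Notation n := #|X|.
Local Notation cnt := (cnt p z).
Local Notation tau := (tau p z d K).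
Local Notation Gv := (Gv z).
Local Notation vec := (vec z).
Local Notation loss := (loss R p z d K).
Local Notation block_size := (block_size R p z d K).
Local Notation potential := (potential R p z d K).
Implicit Types (x : {ffun 'I_k -> X}) (i l : 'I_k) (G H : 'I_k -> int).

(* For r > 0, at the level tau r G every class is within a factor d of n / d^r. *)
Definition visit r G := [forall i, (n <= cnt i (tau r G) (G i) * d ^ r.+1)%N
  && (cnt i (tau r G) (G i) * d ^ r.-1 < n)%N].

(** So many terms of size [kap / 2] exceed 1, where [kap = (d ^ (Q + 2))^-1] bounds the relative
    size of the first subclass from below. *)
Definition chain_len Q := (2 * d ^ (Q + 2)).+1.

(** The threshold of [balance_close] for [rho = d ^ 2] and [lam = kap / (4 * chain_len Q)]: after
    [chain_len Q] steps, each losing at most [2 * lam], at least [kap / 2] remains. *)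
Definition gain Q : R :=
  ((d ^ (Q + 2))%:R^-1 / (4 * (chain_len Q)%:R)) ^+ 2 /
  ((d ^ 2)%:R ^+ 2 * (1 + (d ^ 2)%:R) ^+ 3).

Lemma gain_gt0 Q : 0 < gain Q.
Proof.
have d0 : (0 < d)%N := ltnW d1.
have dn e : 0 < (d ^ e)%:R :> R by rewrite ltr0n expn_gt0 d0.
apply: divr_gt0.
  by apply/exprn_gt0/divr_gt0; rewrite ?invr_gt0 // mulr_gt0 ?ltr0n.
by apply: mulr_gt0; apply: exprn_gt0; rewrite // addr_gt0.
Qed.

Lemma visit_ratio r G i l : (0 < r)%N -> visit r G ->
  (cnt i (tau r G) (G i))%:R <= (d ^ 2)%:R * (cnt l (tau r G) (G l))%:R :> R.
Proof.
move=> r0 /forallP v; have /andP[_ hi] := v i; have /andP[hl _] := v l.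
rewrite -natrM ler_nat; have := ltnW (leq_trans hi hl).
have -> : (d ^ r.+1 = d ^ 2 * d ^ r.-1)%N by rewrite -expnD; congr expn; lia.
by rewrite mulnA leq_pmul2r ?expn_gt0 ?(ltnW d1) // mulnC.
Qed.

(* Changing the coordinate m from x m to y shifts the matching of the subclasses
   of the coordinates i and l by H = z m y - z m (x m); at the depth D where H
   becomes nonzero, p successive shifts visit disjoint subclasses. *)
Lemma loss_dichotomy r r' Q i l m x y : prime p -> (chain_len Q <= p)%N ->
  (0 < r)%N -> (r <= r' <= r + Q)%N -> i != l -> m != l -> i != m ->
  visit r (Gv l x) -> visit r' (Gv l x) ->
  cong p (tau r (Gv l x)) (z m y) (z m (x m)) ->
  ~~ cong p (tau r' (Gv l x)) (z m y) (z m (x m)) ->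
  gain Q <= loss r r' i l x \/ gain Q <= loss r r' i l (upd x m y).
Proof.
move=> pp Mp r0 /andP[rr rQ] il ml im v v' c0 c1.
have rrQ : (r'.+1 <= Q + 2 + r.-1)%N by clear -r0 rQ; lia.
pose H := z m y - z m (x m).
(* [D] is the exact exponent of [p] in [H]; the hypotheses on [y] place it between the two cuts. *)
have [D [sD Ds HD nHD]] : exists D, [/\ (tau r (Gv l x) <= D)%N, (D < tau r' (Gv l x))%N,
    cong p D H 0 & ~~ cong p D.+1 H 0].
  have cH s : cong p s H 0 = cong p s (z m y) (z m (x m)) by rewrite /cong subr0.
  have ex : exists s, ~~ cong p s H 0 by exists (tau r' (Gv l x)); rewrite cH.
  case: (ex_minnP ex) => -[|D] nD minD; first by rewrite cong0 in nD.
  exists D; split => //.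
  - rewrite leqNgt; apply/negP => lt; case/negP: nD; rewrite cH.
    exact: cong_le c0.
  - by apply: minD; rewrite cH.
  - by apply/negPn/negP => /minD; rewrite ltnn.
set x' := upd x m y.
have cx' s : cong p s H 0 -> forall j, cong p s (Gv l x' j) (Gv l x j).
  by move=> h; apply: Gv_upd_cong => //; move: h; rewrite /cong subr0.
have tx' : tau r (Gv l x') = tau r (Gv l x).
  apply: tau_ext => j; rewrite cong_sym; apply: cx'; exact: cong_le HD.
have Dx' : (D < tau r' (Gv l x'))%N.
  by apply: (tau_gt _ Ds) => j; rewrite cong_sym; apply: cx'.
have bs j : block_size r j l x' = block_size r j l x.
  by rewrite /block_size tx' /cnt (cong_card_eq _ (cx' _ (cong_le sD HD) j)).
set A := block_size r i l x; set B := block_size r l l x.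
have d0 : (0 < d)%N := ltnW d1.
have dd : (0 < d ^ 2)%N by rewrite expn_gt0 d0.
have A0 : 0 < A by rewrite /A block_sizeE // ltr0n cong_card_gt0.
have AB : A <= (d ^ 2)%:R * B by exact: visit_ratio.
have BA : B <= (d ^ 2)%:R * A by exact: visit_ratio.
have B0 : 0 < B by move: (lt_le_trans A0 AB); rewrite pmulr_rgt0 // ltr0n.
pose g j := z i (x i) + H * j%:Z.
pose a j : R := (cnt i D.+1 (g j))%:R.
pose b j : R := (cnt l D.+1 (vec l i x (g j) l))%:R.
have cg j : cong p D (g j) (z i (x i)).
  by rewrite /cong /g addrAC subrr add0r; apply: dvdz_mulr; move: HD; rewrite /cong subr0.
have lx j : (a j * B - b j * A) ^+ 2 / (A + B) ^+ 3 / A <= loss r r' i l x.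
  by apply: loss_lower => //; rewrite sD.
(* Passing from [x] to [x'] adds [H] to what [l] must match, so each subclass of [i] is now paired
   with the next subclass of [l]. *)
have lx' j : (a j * B - b j.+1 * A) ^+ 2 / (A + B) ^+ 3 / A <= loss r r' i l x'.
  have := @loss_lower R p k X z d K d1 r r' i l x' D (g j) rr il.
  rewrite tx' sD Dx' {1}/x' updE (negbTE im) cg !bs.
  move=> /(_ isT isT B0) /=; rewrite -/A -/B.
  suff -> : vec l i x' (g j) l = vec l i x (g j.+1) l by [].
  rewrite /vec eqxx; congr (- _).
  rewrite (bigD1 m) ?ml 1?eq_sym //= [in RHS](bigD1 m) ?ml 1?eq_sym //=.
  rewrite /x' updE eqxx (eq_bigr (fun j => z j (x j))); last first.
    by move=> u /andP[_ um]; rewrite updE (negbTE um).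
  by rewrite /g intS /H; ring.
case: (lerP (gain Q) (loss r r' i l x)) => [|h]; first by left.
case: (lerP (gain Q) (loss r r' i l x')) => [|h']; first by right.
exfalso.
set kap : R := (d ^ (Q + 2))%:R^-1.
have kap0 : 0 < kap by rewrite invr_gt0 ltr0n expn_gt0 d0.
set M := chain_len Q in Mp.
have M0 : 0 < M%:R :> R by rewrite ltr0n.
set lam := kap / (4 * M%:R).
have lam0 : 0 < lam by rewrite divr_gt0 // mulr_gt0.
have close (c : R) (w : R) : (c * B - w * A) ^+ 2 / (A + B) ^+ 3 / A < gain Q ->
  `|c / A - w / B| < lam.
  by apply: (balance_close (rho := (d ^ 2)%:R)) => //; rewrite ?ltr0n //; exact: ltW.
suff : 1 < \sum_(j < M) a j / A.
  rewrite ltNge -mulr_suml ler_pdivrMr // mul1r -natr_sum /A block_sizeE // ler_nat.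
  by rewrite (cong_card_progression (z i) (x i) pp HD nHD Mp sD).
apply: (@chained_sum_gt1 _ M kap lam (fun j => a j / A) (fun j => b j / B)) => //.
(* The visit at [r'] bounds the subclass at depth [D.+1] from below, the visit at [r] bounds the
   block from above. *)
- rewrite ler_pdivlMr // ler_pdivrMl ?ltr0n ?expn_gt0 ?d0 // /A /a -natrM ler_nat.
  have /forallP/(_ i)/andP[hi _] := v'; have /forallP/(_ i)/andP[_ hi'] := v.
  have := leq_trans hi' hi; rewrite /g mulr0 addr0.
  have h1 : (cnt i (tau r' (Gv l x)) (Gv l x i) <= cnt i D.+1 (z i (x i)))%N.
    by rewrite (Gv_vec z x il) vec_i //; exact: cong_card_le.
  have h2 : (d ^ r'.+1 <= d ^ (Q + 2) * d ^ r.-1)%N.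
    by rewrite -expnD leq_exp2l.
  move=> h3; have := leq_trans (ltnW h3) (leq_mul h1 h2).
  by rewrite mulnA leq_pmul2r ?expn_gt0 ?d0 // mulnC.
- rewrite /lam (_ : 2 * M%:R * (kap / (4 * M%:R)) = kap / 2) //.
  by field; rewrite gt_eqF.
- by rewrite -ltr_pdivrMr // invrK -natrM ltr_nat.
- by move=> j _; apply: close; exact: le_lt_trans (lx j) h.
- by move=> j _; apply: close; exact: le_lt_trans (lx' j) h'.
Qed.

(** For [x] visited at both levels, the distance 3 between them makes the class of coordinate [m]
    shrink by half or more, so at least half of its members [y] fall under [loss_dichotomy].
    Averaging over [y] preserves the total loss; the half and the two alternatives give the factor
    4. *)
Lemma card_visit_pairs r r' Q i l m : prime p -> (chain_len Q <= p)%N ->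
  (0 < r)%N -> (r + 3 <= r' <= r + Q)%N -> i != l -> m != l -> i != m ->
  #|[pred x | visit r (Gv l x) && visit r' (Gv l x)]|%:R * gain Q <=
  4 * (potential r i l - potential r' i l).
Proof.
move=> pp Mp r0 /andP[r3 rQ] il ml im.
have rr : (r <= r')%N by apply: leq_trans r3; exact: leq_addr.
have e1 : (r'.-1 = (r'.-1 - r.+1) + r.+1)%N by clear -r3; lia.
have e2 : (1 <= r'.-1 - r.+1)%N by clear -r3; lia.
have L0 x : 0 <= loss r r' i l x by exact: loss_ge0.
set P := [pred x | _].
have key x : P x -> gain Q / 2 <= loss r r' i l x +
    (\sum_(y | cong p (tau r (Gv l x)) (z m y) (z m (x m))) loss r r' i l (upd x m y)) /
    (cnt m (tau r (Gv l x)) (z m (x m)))%:R.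
  move=> /andP[v v'].
  set c0 := [pred y | cong p (tau r (Gv l x)) (z m y) (z m (x m))].
  set c1 := [pred y | cong p (tau r' (Gv l x)) (z m y) (z m (x m))].
  set W := cnt m (tau r (Gv l x)) (z m (x m)).
  have W0 : 0 < W%:R :> R by rewrite ltr0n cong_card_gt0.
  have c10 y : c1 y -> c0 y by apply: cong_le; exact: tau_mono.
  have Wh : (2 * cnt m (tau r' (Gv l x)) (z m (x m)) <= W)%N.
    have /forallP/(_ m)/andP[_] := v'; have /forallP/(_ m)/andP[+ _] := v.
    rewrite !(Gv_vec z x ml) !vec_i // -/W => h1 h2.
    have := ltnW (leq_trans h2 h1).
    rewrite e1 expnD mulnA leq_pmul2r ?expn_gt0 ?(ltnW d1) //; apply: leq_trans.
    rewrite mulnC leq_mul2l; apply/orP; right.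
    by apply: leq_trans (d1) _; rewrite -[leqLHS]expn1 leq_exp2l.
  have : \sum_(y | c0 y && ~~ c1 y) gain Q <=
      W%:R * loss r r' i l x + \sum_(y | c0 y) loss r r' i l (upd x m y).
    rewrite (_ : W%:R * loss r r' i l x = \sum_(y | c0 y) loss r r' i l x); last first.
      by rewrite sumr_const mulr_natl.
    rewrite -big_split [leRHS](bigID c1)/= ler_wpDl //.
      by apply: sumr_ge0 => y _; rewrite addr_ge0.
    apply: ler_sum => y /andP[h0 h1].
    have [h|h] := @loss_dichotomy r r' Q i l m x y pp Mp r0 (introT andP (conj rr rQ)) il
      ml im v v' h0 h1.
      by rewrite -[leLHS]addr0 lerD.
    by rewrite -[leLHS]add0r lerD.
  rewrite sumr_const -[_ *+ _]mulr_natl => h.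
  rewrite -(ler_pM2l W0) mulrDr [X in _ <= _ + X]mulrCA divff ?gt_eqF // mulr1;
    apply: le_trans h.
  rewrite [leLHS]mulrCA [leRHS]mulrC ler_wpM2l ?(ltW (gain_gt0 _)) //.
  rewrite ler_pdivrMr // -natrM ler_nat.
  have := cardID c1 c0; rewrite (_ : #|c0| = W) // => E.
  have E1 : #|[predI c0 & c1]| = cnt m (tau r' (Gv l x)) (z m (x m)).
    by apply: eq_card => y; rewrite !inE; apply: andb_idl; exact: c10.
  rewrite E1 in E.
  have -> : #|[pred y | c0 y && ~~ c1 y]| = #|[predD c0 & c1]|.
    by apply: eq_card => y; rewrite !inE andbC.
  move: Wh; rewrite -E mul2n -addnn leq_add2l muln2 -addnn leq_add2r; exact.
suff : \sum_(x | P x) (gain Q / 2) <= \sum_x loss r r' i l x + \sum_x loss r r' i l x.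
  rewrite sumr_const -[_ *+ _]mulr_natl !sum_loss //.
  by move=> h; lra.
rewrite -[X in _ <= _ + X](@sum_block_average R p k X z d K r m l _ ml) -big_split /=
  big_mkcond.
apply: ler_sum => x _; case: ifP => [/key//|_].
by rewrite addr_ge0 // divr_ge0 ?ler0n //; apply: sumr_ge0.
Qed.

End Dichotomy.

(** Raising [h] by one adds a sum that telescopes in [b] and is at most [C]. *)
Lemma shifted_sums_sub_le (R : realFieldType) (f : nat -> R) (C : R) (B g h : nat) :
  (forall j, 0 <= f j <= C) ->
  \sum_(b < B) (f (b + g)%N - f (b + g + h)%N) <= h%:R * C.
Proof.
move=> fC; elim: h => [|h IH].
  by rewrite mul0r big1 // => b _; rewrite addn0 subrr.
rewrite (eq_bigr (fun b : 'I_B => (f (b + g)%N - f (b + g + h)%N) +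
   - (f (b.+1 + (g + h))%N - f (b + (g + h))%N))); last first.
  by move=> b _; rewrite addSn addnS -addnA; ring.
rewrite big_split/= sumrN
  -(big_mkord xpredT (fun b => f (b.+1 + (g + h))%N - f (b + (g + h))%N)).
rewrite telescope_sumr // add0n -natr1 mulrDl mul1r lerD //.
have := fC (B + (g + h))%N; have := fC (g + h)%N; lra.
Qed.

(** If the first [v] holds, every later one forms a pair with it; otherwise it is dropped and
    induction applies. *)
Lemma sum_le1_pairs (L : nat) (v : nat -> bool) :
  (\sum_(g < L) v g <= 1 + \sum_(g < L) \sum_(h < L) (v g && v (g + h.+1)))%N.
Proof.
elim: L v => [|L IH] v; first by rewrite big_ord0.
rewrite big_ord_recl [X in (_ <= 1 + X)%N]big_ord_recl /=.
case: (boolP (v 0%N)) => v0 /=; last first.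
  apply: leq_trans (IH (fun j => v j.+1)) _; rewrite leq_add2l.
  apply: leq_trans (leq_addl _ _); apply: leq_sum => g _.
  by rewrite [leqRHS]big_ord_recr /=; apply: leq_trans (leq_addr _ _); apply: leq_sum.
rewrite leq_add2l; apply: leq_trans (leq_addr _ _).
by rewrite [leqRHS]big_ord_recr /=; apply: leq_trans (leq_addr _ _); apply: leq_sum.
Qed.

(** If all the levels [4 * j + 1] with [j < B + L] were visited often, each window of [L] of them
    would contain many doubly visited tuples. These force the potential to drop, while the drops
    summed over [B] windows telescope to a bound independent of [B]. *)
Lemma exists_rare_visit (R : archiRealFieldType) (k d : nat) (eps : R) : (1 < d)%N ->
  0 < eps ->
  exists Rm Pm : nat, forall (p K : nat) (X : finType) (z : 'I_k -> X -> int)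
    (i l m : 'I_k),
    prime p -> (Pm <= p)%N -> i != l -> m != l -> i != m -> (0 < #|X|)%N ->
    exists2 r, (0 < r <= Rm)%N &
      #|[pred x | visit p z d K r (Gv z l x)]|%:R <= eps * #|X|%:R ^+ k.
Proof.
move=> d1 e0.
have [L hL] : exists L : nat, 2 <= L%:R * eps.
  exists (Num.bound (2 / eps)); rewrite -ler_pdivrMr //.
  by apply/ltW/archi_boundP; rewrite divr_ge0 // ltW.
pose Q := (4 * L)%N; pose c := gain R d Q.
have c0 : 0 < c := gain_gt0 R d1 Q.
have [B hB] : exists B : nat, L%:R * L%:R * (4 / c) * L%:R < B%:R :> R.
  exists (Num.bound (L%:R * L%:R * (4 / c) * L%:R : R)).
  by apply/archi_boundP; rewrite !mulr_ge0 ?ler0n ?invr_ge0 ?ltW.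
exists (4 * (B + L) + 1)%N, (chain_len d Q) => p K X z i l m pp Pp il ml im n0.
(* The step 4 meets the distance 3 required by [card_visit_pairs] and keeps pairs within
   [Q = 4 * L]. *)
pose rho j := (4 * j + 1)%N.
pose v j := [pred x | visit p z d K (rho j) (Gv z l x)].
pose N : R := #|X|%:R ^+ k.
have N0 : 0 < N by rewrite exprn_gt0 // ltr0n.
case: (boolP [exists j : 'I_(B + L), #|v j|%:R <= eps * N]) => [/existsP[j hj]|].
  exists (rho j) => //; have := ltn_ord j; rewrite /rho; clear; lia.
rewrite negb_exists => /forallP nv; exfalso.
have vlow b g : (b < B)%N -> (g < L)%N -> eps * N <= #|v (b + g)%N|%:R.
  move=> bB gL; have bgL : (b + g < B + L)%N by rewrite -addSn leq_add // ltnW.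
  by have := nv (Ordinal bgL); rewrite -ltNge => /ltW.
have up b : (b < B)%N -> L%:R * (eps * N) <= N + \sum_(g < L) \sum_(h < L)
    #|[pred x | v (b + g)%N x && v (b + g + h.+1)%N x]|%:R.
  move=> bB; apply: (@le_trans _ _ (\sum_(g < L) #|v (b + g)%N|%:R)).
    rewrite mulr_natl -[X in _ *+ X]card_ord -sumr_const; apply: ler_sum => g _.
    by apply: vlow.
  have -> : N = (\sum_(x : {ffun 'I_k -> X}) 1)%N%:R.
    by rewrite sum1_card card_ffun card_ord natrX.
  rewrite -!natr_sum.
  under [X in _ <= _ + X]eq_bigr do rewrite -natr_sum.
  rewrite -natr_sum -natrD ler_nat.
  under eq_bigr do rewrite -sum1_card big_mkcond.
  under [X in (_ <= _ + X)%N]eq_bigr do under eq_bigr do rewrite -sum1_card big_mkcond.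
  under [X in (_ <= _ + X)%N]eq_bigr do rewrite exchange_big.
  rewrite exchange_big [X in (_ <= _ + X)%N]exchange_big -big_split/=.
  apply: leq_sum => x _; have := sum_le1_pairs L (fun g => v (b + g)%N x).
  congr (_ <= _)%N.
  congr (1 + _)%N; apply: eq_bigr => g _; apply: eq_bigr => h _.
  by rewrite addnA.
have pairs b g h : (h < L)%N ->
   #|[pred x | v (b + g)%N x && v (b + g + h.+1)%N x]|%:R <=
   4 / c * (potential R p z d K (rho (b + g)) i l - potential R p z d K
     (rho (b + g + h.+1)) i l).
  move=> hL'; rewrite mulrAC ler_pdivlMr //.
  apply: (@card_visit_pairs R p k X z d K d1 (rho (b + g)%N) (rho (b + g + h.+1)%N) Q i l
    m) => //.
    by rewrite /rho addn1.
  by move: hL'; rewrite /rho /Q; clear; lia.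
have total : B%:R * (L%:R * (eps * N)) <= B%:R * N + L%:R * L%:R * (4 / c) * L%:R * N.
  apply: (@le_trans _ _ (\sum_(b < B) (N + \sum_(g < L) \sum_(h < L)
    #|[pred x | v (b + g)%N x && v (b + g + h.+1)%N x]|%:R))).
    rewrite mulr_natl -[X in _ *+ X]card_ord -sumr_const; apply: ler_sum => b _.
    exact: up.
  rewrite big_split/= sumr_const card_ord mulr_natl lerD2l exchange_big/=.
  rewrite -!mulrA mulr_natl -[X in _ *+ X]card_ord -sumr_const; apply: ler_sum => g _.
  rewrite exchange_big/= mulr_natl -[X in _ *+ X]card_ord -sumr_const;
    apply: ler_sum => h _.
  apply: le_trans (_ : _ <= \sum_(b < B) _) _.
    by apply: ler_sum => b _; exact: pairs (ltn_ord h).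
  rewrite -mulr_sumr -mulrA !ler_pM2l ?invr_gt0 //.
  apply: le_trans (@shifted_sums_sub_le R (fun j => potential R p z d K (rho j) i l) N B g
    h.+1 _) _.
    by move=> j; rewrite potential_ge0 potential_le.
  by rewrite ler_wpM2r ?ler_nat // ltW.
have : 2 * N * B%:R <= B%:R * (L%:R * (eps * N)).
  rewrite mulrC ler_wpM2l ?ler0n // mulrA ler_wpM2r // ltW //.
have : L%:R * L%:R * (4 / c) * L%:R * N < B%:R * N by rewrite ltr_pM2r.
lra.
Qed.

Section Misaligned.
Variables (p k : nat) (X : finType) (z : 'I_k -> X -> int) (d K : nat).
Local Notation n := #|X|.
Local Notation cnt := (cnt p z).
Local Notation tau := (tau p z d K).

Definition misaligned r (G : 'I_k -> int) := [exists i, exists j,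
  (cnt i (tau r G) (G i) * d ^ r < n)%N && (n <= cnt j (tau r G) (G j) * d ^ r)%N].

Definition unbalanced r i l (G : 'I_k -> int) :=
  (cnt i (tau r G) (G i) * d < cnt l (tau r G) (G l))%N.

(** Without an unbalanced pair all classes are within a factor [d] of each other, and a light and a
    heavy one pin them near [n / d ^ r]. *)
Lemma misaligned_cases r G : (0 < r)%N -> misaligned r G ->
  visit p z d K r G || [exists i, exists l, (i != l) && unbalanced r i l G].
Proof.
move=> r0 /existsP[i0 /existsP[j0 /andP[hi hj]]].
case: (boolP [exists i, exists l, _]); rewrite ?orbT // orbF => /existsPn nb.
have bal i l : (cnt l (tau r G) (G l) <= cnt i (tau r G) (G i) * d)%N.
  have /existsPn/(_ l) := nb i; rewrite negb_and negbK => /orP[/eqP->|].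
    case: (posnP d) => [d0|]; last exact: leq_pmulr.
    by move: hj; rewrite d0 exp0n // muln0 leqNgt (leq_ltn_trans _ hi).
  by rewrite /unbalanced -leqNgt.
apply/forallP => j; apply/andP; split.
  apply: leq_trans hj _; rewrite expnS mulnA leq_mul2r; apply/orP; right; exact: bal.
have dr : (d ^ r = d * d ^ r.-1)%N by rewrite -expnS prednK.
apply: leq_ltn_trans hi; rewrite dr mulnA leq_mul2r.
by apply/orP; right; exact: bal.
Qed.

Lemma card_misaligned r l0 : (0 < r)%N -> (1 < d)%N -> (forall i, injective (z i)) ->
  (#|[pred x : {ffun 'I_k -> X} | (\sum_i z i (x i) == 0)%R &&
    misaligned r (fun i => z i (x i))]| * n * d
   <= #|[pred x | visit p z d K r (Gv z l0 x)]| * d + k ^ 2 * n ^ k)%N.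
Proof.
move=> r0 d1 zi.
pose sol (x : {ffun 'I_k -> X}) := \sum_i z i (x i) == 0.
pose V := [pred x : {ffun 'I_k -> X} | sol x && visit p z d K r (fun i => z i (x i))].
pose U i l := [pred x : {ffun 'I_k -> X} |
  sol x && unbalanced r i l (fun i => z i (x i))].
have cover : (#|[pred x : {ffun 'I_k -> X} | sol x && misaligned r (fun i => z i (x i))]|
  <= #|V| + \sum_i \sum_(l | i != l) #|U i l|)%N.
  under eq_bigr do under eq_bigr do rewrite -sum1_card big_mkcond.
  under eq_bigr do rewrite exchange_big.
  rewrite exchange_big/= -!sum1_card big_mkcond [X in (_ <= X + _)%N]big_mkcond
    -big_split/=.
  apply: leq_sum => x _; rewrite !inE;
    case: ifP => // /andP[sx /(misaligned_cases r0)/orP[vx|]].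
    by rewrite sx vx.
  move=> /existsP[i /existsP[l /andP[il ux]]];
    rewrite (bigD1 i)//= (bigD1 l)//= inE sx ux.
  by rewrite -addnA addnCA.
have eG G H : G =1 H -> tau r G = tau r H by exact: eq_tau.
have hV : (#|V| * n <= #|[pred x | visit p z d K r (Gv z l0 x)]|)%N.
  apply: card_sol_le => // G H GH; apply: eq_forallb => i; by rewrite (eG _ _ GH) GH.
have hU i l : i != l -> (#|U i l| * n * d <= n ^ k)%N.
  move=> il; apply: leq_trans (card_unbalanced rat p z K d1 r il).
  rewrite leq_mul2r; apply/orP; right; apply: card_sol_le => // G H GH.
  by rewrite /unbalanced (eG _ _ GH) !GH.
apply: leq_trans (leq_mul (leq_mul cover (leqnn n)) (leqnn d)) _.
rewrite !mulnDl leq_add // ?leq_mul2r ?hV ?orbT //.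
rewrite !big_distrl/= expnS expn1 -mulnA -[X in (_ <= X * _)%N](card_ord k)
  -sum_nat_const.
apply: leq_sum => i _; rewrite !big_distrl/=.
rewrite -[X in (_ <= X * _)%N](card_ord k) -sum_nat_const big_mkcond.
by apply: leq_sum => l _; case: ifP => // /hU.
Qed.

End Misaligned.

Lemma misaligned_rare (R : archiRealFieldType) (k : nat) (eps : R) : (2 < k)%N ->
  0 < eps ->
  exists d Rm Pm : nat, (1 < d)%N /\
    forall (p K : nat) (X : finType) (z : 'I_k -> X -> int),
    prime p -> (Pm <= p)%N -> (0 < #|X|)%N -> (forall i, injective (z i)) ->
    exists2 r, (0 < r <= Rm)%N &
      #|[pred x : {ffun 'I_k -> X} | (\sum_i z i (x i) == 0) &&
           misaligned p z d K r (fun i => z i (x i))]|%:R <= eps * #|X|%:R ^+ k.-1.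
Proof.
move=> k2 e0; have e2 : 0 < eps / 2 by rewrite divr_gt0.
(* The unbalanced tuples make up a proportion [k ^ 2 / d], at most [eps / 2]; the other half is left
   to the visits. *)
have [d d1 hd] : exists2 d : nat, (1 < d)%N & (k ^ 2)%:R <= eps / 2 * d%:R.
  have := archi_boundP (_ : 0 <= (k ^ 2)%:R / (eps / 2)).
  rewrite divr_ge0 ?ler0n ?(ltW e2) // => /(_ isT); set b := Num.bound _ => hb.
  exists b.+2 => //; rewrite mulrC -ler_pdivrMr //; apply: le_trans (ltW hb) _.
  by rewrite ler_nat; lia.
have [Rm [Pm H]] := @exists_rare_visit R k d (eps / 2) d1 e2.
exists d, Rm, Pm; split=> // p K X z pp Pp n0 zi.
pose i : 'I_k := Ordinal (ltnW (ltnW k2)); pose l : 'I_k := Ordinal (ltnW k2).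
pose m : 'I_k := Ordinal k2.
have [r /[dup] rR /andP[r0 _] hr] := H p K X z i l m pp Pp isT isT isT n0.
exists r => //; have := @card_misaligned p k X z d K r l r0 d1 zi.
set bad := #|_|; set vis := #|_| in hr *.
have n0' : 0 < #|X|%:R :> R by rewrite ltr0n.
have d0' : 0 < d%:R :> R by rewrite ltr0n ltnW.
rewrite -(ler_nat R) natrD !natrM !natrX => h.
have kE : #|X|%:R ^+ k =
  #|X|%:R ^+ k.-1 * #|X|%:R :> R by rewrite -exprSr prednK // ltnW // ltnW.
rewrite -(ler_pM2r n0') -(ler_pM2r d0'); apply: le_trans h _.
rewrite -[X in _ <= X * _]mulrA -kE.
have h1 : vis%:R * d%:R <= eps / 2 * #|X|%:R ^+ k * d%:R by rewrite ler_pM2r.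
have h2 : k%:R ^+ 2 * #|X|%:R ^+ k <= eps / 2 * d%:R * #|X|%:R ^+ k.
  by rewrite ler_wpM2r ?exprn_ge0 // -natrX.
apply: le_trans (lerD h1 h2) _; rewrite le_eqVlt; apply/orP; left; apply/eqP.
by field.
Qed.

(** * Zero-sum tuples of k sets *)

(* Let x be the largest element of A and z that of E.  The differences along the
   hook formed by the row of x and the column of z are distinct; peel it off. *)
Lemma hook_sum (f : int -> nat) (D : nat -> nat)
    (fD : forall L : seq int, uniq L -> (\sum_(w <- L) f w <= D (size L))%N)
    (A E : seq int) : uniq A -> uniq E ->
  (\sum_(x <- A) \sum_(z <- E) f (z - x)%R <=
   \sum_(t < minn (size A) (size E)) D (size A + size E - t.*2.+1))%N.
Proof.
have gtT : transitive (>%R : rel int) := rev_trans lt_trans.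
have sorted_case (B F : seq int) : sorted >%R B -> sorted >%R F ->
    (\sum_(x <- B) \sum_(z <- F) f (z - x)%R <=
     \sum_(t < minn (size B) (size F)) D (size B + size F - t.*2.+1))%N.
  elim: B F => [|x B IH] [|z F] sB sF; first by rewrite big_nil.
  - by rewrite big_nil.
  - by rewrite big1 // => y _; rewrite big_nil.
  have [sB' sF'] : sorted >%R B /\ sorted >%R F by rewrite (path_sorted sB)
    (path_sorted sF).
  have xB (y : int) : y \in B -> y < x.
    by move=> yB; move: sB => /= /(order_path_min gtT)/allP/(_ y yB).
  have zF (y : int) : y \in F -> y < z.
    by move=> yB; move: sF => /= /(order_path_min gtT)/allP/(_ y yB).
  pose L := [seq y - x | y <- z :: F] ++ [seq z - y | y <- B].
  have uL : uniq L.
    rewrite cat_uniq !map_inj_uniq; last 2 first.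
    - by move=> u v /addrI/oppr_inj.
    - by move=> u v /addIr.
    have uE : uniq (z :: F) by apply: (sorted_uniq gtT ltxx).
    have uB : uniq B by apply: (sorted_uniq gtT ltxx).
    rewrite uE uB andbT; apply/hasPn => _ /mapP [y yB ->].
    apply/negP => /mapP[v]; rewrite inE => vE.
    have := xB y yB; have : v <= z by case/orP: vE => [/eqP->//|/zF/ltW].
    lia.
  have {uL}/fD := uL.
  rewrite big_cat !big_map size_cat !size_map => fL.
  rewrite big_cons.
  have -> : (\sum_(y <- B) \sum_(u <- z :: F) f (u - y)%R =
     \sum_(y <- B) f (z - y)%R + \sum_(y <- B) \sum_(u <- F) f (u - y)%R)%N.
    by rewrite -big_split; apply: eq_bigr => y _; rewrite big_cons.
  rewrite addnA minnSS big_ord_recl/=.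
  apply: leq_add.
    rewrite double0 subn1 addSn/= (addnC (size B)); exact: fL.
  apply: leq_trans (IH _ sB' sF') _.
  apply: leq_sum => t _; rewrite /bump/=.
  by rewrite (_ : (size B + size F - (t : nat).*2.+1 =
    (size B).+1 + (size F).+1 - (1 + t).*2.+1)%N) //; lia.
move=> uA uE; pose B := sort (fun x y : int => y <= x) A;
  pose F := sort (fun x y : int => y <= x) E.
have ge_tot : total (fun x y : int => y <= x) by move=> x y; exact: le_total.
have sBF (C : seq int) : uniq C -> sorted >%R (sort (fun x y : int => y <= x) C).
  move=> uC; have := sort_sorted ge_tot C.
  have : uniq (sort (fun x y : int => y <= x) C) by rewrite sort_uniq.
  case: (sort _ C) => //= y C'; elim: C' y => //= u C' IHC y /andP[+ /IHC uC'].
  rewrite inE negb_or => /andP[yu _] /andP[uy /uC' ->].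
  by rewrite lt_neqAle uy eq_sym yu.
have := sorted_case B F (sBF _ uA) (sBF _ uE).
have pB : perm_eq B A by rewrite perm_sort.
have pF : perm_eq F E by rewrite perm_sort.
rewrite (perm_big _ pB)/= !(perm_size pB) !(perm_size pF).
by under eq_bigr do rewrite (perm_big _ pF)/=.
Qed.

Fixpoint sum_reps (As : seq (seq int)) (w : int) : nat :=
  (if As is A :: As' then \sum_(x <- A) sum_reps As' (w - x)%R else (w == 0)%R)%N.

(** [hook_sum] iterated over the sets: a bound for the number of representations summed over [e]
    distinct targets. With no set left, only the target 0 is represented, and once. *)
Fixpoint hook_bound (ns : seq nat) (e : nat) : nat :=
  (if ns is a :: ns' then \sum_(t < minn a e) hook_bound ns' (a + e - t.*2.+1)
  else 0 < e)%N.

Lemma sum_reps_le (As : seq (seq int)) (L : seq int) : all uniq As -> uniq L ->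
  (\sum_(w <- L) sum_reps As w <= hook_bound (map size As) (size L))%N.
Proof.
elim: As L => [|A As IH] L /= => [_ uL|/andP[uA uAs] uL].
  have -> : (\sum_(w <- L) (w == 0)%R = count (pred1 0%R) L)%N.
    by rewrite -sum1_count [RHS]big_mkcond; apply: eq_bigr => w _ /=; case: (w == 0).
  by rewrite count_uniq_mem //; case: L {uL} => //= *; case: (_ \in _).
rewrite exchange_big/=; apply: hook_sum => //.
by move=> L' uL'; apply: IH.
Qed.

(** The first set, negated, serves as the set of targets. *)
Lemma sum_reps0_le (A : seq int) (As : seq (seq int)) : uniq A -> all uniq As ->
  (sum_reps (A :: As) 0 <= hook_bound (map size As) (size A))%N.
Proof.
move=> uA uAs; have := @sum_reps_le As (map -%R A) uAs.
rewrite map_inj_uniq; last exact: oppr_inj.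
move=> /(_ uA); rewrite big_map size_map /=.
by under eq_bigr do rewrite -sub0r.
Qed.

Lemma sum_reps_count (As : seq (seq int)) (w : int) (P : seq (seq int)) : uniq P ->
  (forall s, s \in P -> all2 (fun x A => x \in A) s As && (\sum_(x <- s) x == w)) ->
  (size P <= sum_reps As w)%N.
Proof.
elim: As w P => [|A As IH] w P uP PP.
  have nilP s : s \in P -> (s == [::]) && (w == 0).
    by case: s => [|a s] /PP // ; rewrite big_nil eq_sym => /andP[].
  have /eq_in_count : {in P, predT =1 pred1 [::]} by move=> s /nilP/andP[/eqP->].
  rewrite count_predT count_uniq_mem // => -> /=.
  by case: (boolP (_ \in _)) => // /nilP /andP[_ ->].
pose Px x := [seq behead s | s <- P & head 0 s == x].
have Pcons s : s \in P -> s = head 0 s :: behead s by case: s => // /PP.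
apply: (@leq_trans (\sum_(x <- A) size (Px x))); last first.
  apply: leq_sum => x _; apply: IH.
    rewrite map_inj_in_uniq ?filter_uniq // => s s'.
    rewrite !mem_filter => /andP[/eqP hs sP] /andP[/eqP hs' s'P] e.
    by rewrite (Pcons _ sP) (Pcons _ s'P) hs hs' e.
  move=> _ /mapP[s + ->]; rewrite mem_filter => /andP[/eqP <- sP].
  have := PP _ sP; rewrite {1 2}(Pcons _ sP)/= big_cons => /andP[/andP[_ ->] /eqP <-].
  by rewrite addrC addKr /=.
under eq_bigr do rewrite size_map size_filter -sum1_count big_mkcond.
rewrite exchange_big/= -sum1_size; rewrite big_seq_cond [leqRHS]big_seq_cond.
apply: leq_sum => s /andP[sP _].
have := PP _ sP; rewrite {1}(Pcons _ sP)/= => /andP[/andP[hA _] _].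
by rewrite (big_rem _ hA)/= eqxx.
Qed.

Lemma all2_map_maps (I : Type) (T U : Type) (r : T -> U -> bool) (f : I -> T) (g : I -> U)
  (s : seq I) :
  all2 r (map f s) (map g s) = all (fun i => r (f i) (g i)) s.
Proof. by elim: s => //= i s ->. Qed.

(** * Solutions graded by two depth functions *)

Section Graded.
Variables (k p q : nat) (X : finType) (v : X -> int) (g1 g2 : X -> nat).
Hypotheses (k2 : (2 < k)%N) (p0 : (0 < p)%N) (q0 : (0 < q)%N) (v_inj : injective v).

Let scaled x : int := (p ^ g1 x * q ^ g2 x)%N%:Z * v x.
(** The value for which [base] plus the powers [2 ^ i] with [0 < i < k] vanishes, so that the grades
    of a solution cancel. *)
Let base : int := - (2 ^ k - 2)%N%:Z.
Let grade x : int := 2 ^+ g1 x * base ^+ g2 x.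
(** Large enough for [psi x = psi y] to force equal grades. *)
Let gap : int := (1 + 2 * \sum_x `|scaled x|%N)%N%:Z.
Let psi x : int := scaled x + gap * grade x.

(** In absolute value [grade] is [2 ^ (g1 + g2) * w ^ g2] with [w = 2 ^ k.-1 - 1] odd and greater
    than 1: the power of 2 gives [g1 + g2], the cofactor [g2]. *)
Let grade_inj x y : grade x = grade y -> g1 x = g1 y /\ g2 x = g2 y.
Proof.
move=> /(congr1 absz); rewrite /grade !abszM !abszX /base !abszN /=.
have [w wE w1] : exists2 w, (2 ^ k - 2 = 2 * w)%N & (1 < w)%N /\ odd w.
  exists (2 ^ k.-1).-1; first by rewrite -[in LHS](prednK (ltnW (ltnW k2))) expnS; lia.
  have : (2 ^ 2 <= 2 ^ k.-1)%N by rewrite leq_exp2l // -ltnS prednK // ltnW // ltnW.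
  split; first by lia.
  have : ~~ odd (2 ^ k.-1) by rewrite oddX orbF; case: (k) k2 => [|[]].
  by have := expn_gt0 2 k.-1; case: (2 ^ k.-1)%N => //= a _; rewrite negbK.
rewrite wE !expnMn !mulnA -!expnD; case: w1 => w1 ow.
have l2 a b : logn 2 (2 ^ a * w ^ b) = a.
  rewrite lognM ?expn_gt0 ?(ltnW w1) // pfactorK // lognX lognE.
  by rewrite dvdn2 ow /= andbF muln0 addn0.
move=> E; have := congr1 (logn 2) E; rewrite !l2 => e1.
move/eqP: E; rewrite e1 eqn_pmul2l ?expn_gt0 // => /eqP/(expnI w1) e2.
by split=> //; lia.
Qed.

Let scaled_le x : (2 * `|scaled x| < `|gap|)%N.
Proof. by rewrite /gap /= ltnS leq_mul2l /= (bigD1 x) //= leq_addr. Qed.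

Lemma psi_inj : injective psi.
Proof.
move=> x y E; have hx := scaled_le x; have hy := scaled_le y.
have eg : gap * (grade x - grade y) = scaled y - scaled x.
  by move: E; rewrite /psi => E; rewrite mulrBr; lia.
have e0 : grade x - grade y = 0.
  apply/eqP; rewrite -absz_eq0 -leqn0 -ltnS -(ltn_pmul2l (m := `|gap|)) //.
  rewrite -abszM eg muln1; lia.
have [e1 e2] := grade_inj (subr0_eq e0).
move: eg; rewrite e0 mulr0 /scaled e1 e2 => /esym/eqP.
rewrite -mulrBr mulf_eq0 subr_eq0 => /orP[|/eqP/v_inj//].
by rewrite eqz_nat eqn0Ngt muln_gt0 !expn_gt0 p0 q0.
Qed.

Let k0 : (0 < k)%N := ltnW (ltnW k2).
Let color x : 'I_k := Ordinal (ltn_pmod (g1 x) k0).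
(** The position of colour [j] in a solution whose first coordinate has [g1] equal to [C]. *)
Let shift C (j : 'I_k) : 'I_k := Ordinal (ltn_pmod (j + (k - C %% k)) k0).
Let fiber (j : 'I_k) : seq int := [seq psi x | x <- enum X & color x == j].

Let shiftE C j : ((C + shift C j) %% k = j)%N.
Proof.
rewrite /= modnDmr addnC -modnDmr -addnA subnK; last exact: ltnW (ltn_pmod _ k0).
by rewrite modnDr modn_small.
Qed.

Let shift_inj C : injective (shift C).
Proof. by move=> i j e; apply/val_inj; rewrite /= -(shiftE C i) e shiftE. Qed.

(* The colours g1 mod k make every solution rainbow, and psi turns all of them,
   whatever the colour of their first coordinate, into zero-sum tuples of one
   fixed system of k disjoint sets. *)
Lemma graded_solutions_le (P : pred {ffun 'I_k -> X}) :
  (forall x, P x -> \sum_(i < k) (p ^ i * q ^ (i == 0 :> nat))%N%:Z * v (x i) = 0 /\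
     exists C C' : nat, forall i : 'I_k,
       g1 (x i) = (C + i)%N /\ g2 (x i) = (C' + (i == 0 :> nat))%N) ->
  exists2 ns, size ns = k /\ sumn ns = #|X| &
    (#|P| <= hook_bound (behead ns) (head 0 ns))%N.
Proof.
move=> hP; pose Bs := [seq fiber j | j <- enum 'I_k].
have uB : all uniq Bs.
  by apply/allP => _ /mapP[j _ ->];
    rewrite (map_inj_uniq psi_inj) filter_uniq // enum_uniq.
pose o0 : 'I_k := Ordinal k0.
pose enc (x : {ffun 'I_k -> X}) := [seq psi (x (shift (g1 (x o0)) j)) | j <- enum 'I_k].
have gP x : P x -> forall i : 'I_k, g1 (x i) = (g1 (x o0) + i)%N.
  by move=> /hP[_ [C [C' h]]] i; rewrite !(h _).1 addn0.
have enc_inj : {in P &, injective enc}.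
  move=> x y xP yP /eq_in_map E.
  have Ej j : x (shift (g1 (x o0)) j) = y (shift (g1 (y o0)) j).
    by apply: psi_inj; apply: E; rewrite mem_enum.
  (* The first coordinate has the least [g1]. It reappears among the coordinates of the other tuple,
     so the two minima, and with them the shifts, agree. *)
  have half u w : P u -> P w ->
    (forall j, u (shift (g1 (u o0)) j) = w (shift (g1 (w o0)) j)) ->
      (g1 (w o0) <= g1 (u o0))%N.
    move=> uP wP Euw; have [f _ fK] := injF_bij (@shift_inj (g1 (u o0))).
    by have := congr1 g1 (Euw (f o0)); rewrite fK (gP w) // => ->; exact: leq_addr.
  have eC : g1 (x o0) = g1 (y o0) by apply/eqP; rewrite eqn_leq !half.
  apply/ffunP => i; have [f _ fK] := injF_bij (@shift_inj (g1 (x o0))).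
  by have := Ej (f i); rewrite -eC fK.
exists (map size Bs).
  split; first by rewrite /Bs 2!size_map size_enum_ord.
  rewrite sumnE /Bs 2!big_map big_enum /=.
  under eq_bigr do rewrite size_map size_filter -sum1_count big_mkcond big_enum /=.
  rewrite exchange_big /= -sum1_card; apply: eq_bigr => x _.
  by rewrite (bigD1 (color x)) //= eqxx big1 // => j; rewrite eq_sym => /negbTE ->.
have : (#|P| <= sum_reps Bs 0)%N.
  rewrite cardE -(size_map enc); apply: sum_reps_count.
    rewrite map_inj_in_uniq ?enum_uniq // => x y; rewrite !mem_enum; exact: enc_inj.
  move=> _ /mapP[x + ->]; rewrite mem_enum => xP; rewrite all2_map_maps; apply/andP;
    split.
    apply/allP => j _; apply: map_f; rewrite mem_filter mem_enum andbT.
    by apply/eqP/val_inj; rewrite /= gP // shiftE.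
  have [s0 [C [C' h]]] := hP x xP.
  rewrite big_map big_enum /=
    -(reindex_inj (@shift_inj _) (P := predT) (F := fun i => psi (x i))) /=.
  rewrite big_split /= -mulr_sumr.
  have -> : \sum_i scaled (x i) =
    (p ^ C * q ^ C')%N%:Z * \sum_(i < k) (p ^ i * q ^ (i == 0 :> nat))%N%:Z * v (x i).
    rewrite mulr_sumr; apply: eq_bigr => i _;
      rewrite /scaled (h i).1 (h i).2 mulrA -PoszM.
    by rewrite !expnD mulnACA.
  rewrite s0 mulr0 add0r.
  have -> : \sum_i grade (x i) =
    2 ^+ C * base ^+ C' * (base + \sum_(i < k | i != o0) 2 ^+ i).
    rewrite (bigD1 o0) //= mulrDr mulr_sumr; congr (_ + _).
      by rewrite /grade (h o0).1 (h o0).2 !exprD expr0 expr1 mulr1 mulrA.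
    apply: eq_bigr => i i0; rewrite /grade (h i).1 (h i).2.
    have /negbTE -> : (i : nat) != 0%N by apply: contraNneq i0 => i0; apply/eqP/val_inj.
    by rewrite addn0 exprD mulrAC.
  suff -> : \sum_(i < k | i != o0) 2 ^+ i = - base by rewrite subrr !mulr0.
  have := subrX1 (2 : int) k; rewrite (bigD1 o0)//= expr0 => e.
  rewrite /base opprK -subzn; last by rewrite -{1}(expn1 2) leq_exp2l.
  rewrite -[(2 ^ k)%N%:Z]natz natrX; move: e; rewrite -natz.
  move: (2 ^+ k) (\sum_(_ < k | _) _) => a b; lia.
have sB : size Bs = k by rewrite size_map size_enum_ord.
case: Bs uB sB => [|A As] /=; first by move=> _ kE; have := k0;
  rewrite -[X in (0 < X)%N]kE.
by move=> /andP[uA uAs] _ /leq_trans -> //; exact: sum_reps0_le.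
Qed.

End Graded.

(** * Sections of boxes *)

(* sign_prim m is the m-th primitive of the sign function, and half_diff a f is
   half of the integral of f' over [x - a, x + a].  Hence, for a list l of k
   side lengths, half_diffs l (sign_prim (k - 1)) at 2 x is the k-fold
   convolution at x of the indicators of the centred intervals. *)
Definition sign_prim (R : realFieldType) (m : nat) (x : R) : R :=
  if m is m'.+1 then `|x| * x ^+ m' / m`!%:R else Num.sg x.

Definition half_diff (R : realFieldType) (a : R) (f : R -> R) (x : R) : R :=
  (f (x + a) - f (x - a)) / 2.

Definition half_diffs (R : realFieldType) (l : seq R) (f : R -> R) : R -> R :=
  foldr (@half_diff R) f l.

Section HalfDiff.
Variable R : realType.
Implicit Types x : R.

Lemma is_derive_normr_mul x : is_derive x 1 (fun y => `|y| * y) (2 * `|x|).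
Proof.
have E : (fun h : R => h^-1 *: (`|h *: (1 : R) + x| * (h *: (1 : R) + x) - `|x| * x)) @
  0^' --> 2 * `|x|.
  apply/cvgrPdist_le => e e0; near=> h.
  have h0 : h != 0 by near: h; exact: nbhs_dnbhs_neq.
  have he : `|h| <= e by near: h; apply: dnbhs0_le.
  rewrite /GRing.scale /= mulr1 distrC.
  rewrite -[2 * _](mulKf h0) -mulrBr normrM normfV ler_pdivrMl ?normr_gt0 //.
  (* The error of the linear approximation is at most [h ^ 2] for all signs of [x] and [h + x]. *)
  apply: (@le_trans _ _ (`|h| * `|h|)); last by rewrite ler_wpM2l.
  rewrite -normrM -expr2 (ger0_norm (sqr_ge0 _)).
  have [x0|x0] := ger0P x; have [hx|hx] := ger0P (h + x).
  - rewrite (_ : (h + x) * (h + x) - x * x - h * (2 * x) = h ^+ 2) ?ger0_norm ?sqr_ge0 //;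
    ring.
  - rewrite ler_norml; apply/andP; split; nra.
  - rewrite ler_norml; apply/andP; split; nra.
  - rewrite (_ : - (h + x) * (h + x) - - x * x - h * (2 * - x) = - h ^+ 2) ?normrN
    ?ger0_norm ?sqr_ge0 //; ring.
apply: DeriveDef; first by apply/cvg_ex; exists (2 * `|x|).
exact/cvg_lim.
Unshelve. all: by end_near. Qed.

(** Starts at [m.+2] because [sign_prim 1] is the absolute value, not differentiable at 0. *)
Lemma is_derive_sign_prim m x : is_derive x 1 (sign_prim m.+2) (sign_prim m.+1 x).
Proof.
rewrite /sign_prim.
have -> : (fun x : R => `|x| * x ^+ m.+1 / m.+2`!%:R) =
  (fun y => ((m.+2)`!%:R^-1 * ((`|y| * y) * y ^+ m))).
  by apply/funext => y; rewrite exprS mulrA mulrC.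
have d1 := is_derive_normr_mul x.
have d2 := @is_deriveX R R id m x 1 1 (is_derive_id _ _).
have d3 := is_deriveM d1 d2.
have d4 := is_deriveZ (m.+2`!%:R^-1) d3.
move: d4; set F := (X in is_derive _ _ X _) => d4.
rewrite (_ : (fun y => _) = F); last by apply/funext => y; rewrite /F /= exprfctE.
apply: is_derive_eq; rewrite /GRing.scale /= mulr1.
have f0 : (m.+1)`!%:R != 0 :> R by rewrite pnatr_eq0 -lt0n fact_gt0.
have N0 : 2 + m%:R != 0 :> R by rewrite -natrD pnatr_eq0.
have e : x * (m%:R * x ^+ m.-1) = m%:R * x ^+ m.
  by case: (m) => [|m']; rewrite ?mul0r ?mulr0 // mulrCA -exprS.
rewrite factS natrM exprfctE -(mulrA `|x|) e.
by field; rewrite f0 N0.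
Qed.

End HalfDiff.

Section HalfDiffTheory.
Variable R : realType.
Implicit Types (l : seq R) (f g : R -> R) (a b x y : R).

Lemma half_diffC a b f : half_diff a (half_diff b f) = half_diff b (half_diff a f).
Proof.
apply/funext => x; rewrite /half_diff.
by rewrite ![x + a + _]addrAC ![x - a + _]addrAC; ring.
Qed.

Lemma half_diffs_perm l l' f : perm_eq l l' -> half_diffs l f = half_diffs l' f.
Proof.
apply: (catCA_perm_subst (F := fun l => half_diffs l f)) => s1 s2 s3.
rewrite /half_diffs !foldr_cat; set g := foldr _ f s3.
elim: s1 => //= a s1 ->; elim: s2 => //= b s2 IH.
by rewrite half_diffC IH.
Qed.

Lemma half_diffs_parity l f e x : (forall y, f (- y) = (-1) ^+ e * f y) ->
  half_diffs l f (- x) = (-1) ^+ (e + size l) * half_diffs l f x.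
Proof.
move=> fe; elim: l x => [|a l IH] x /=; first by rewrite addn0.
rewrite addnS exprS /half_diff (_ : - x + a = - (x - a)); last by ring.
by rewrite (_ : - x - a = - (x + a)) ?IH; ring.
Qed.

Lemma sign_prim_parity m x : sign_prim m (- x) = (-1) ^+ m.+1 * sign_prim m x.
Proof.
case: m => [|m]; rewrite /sign_prim; first by rewrite sgrN expr1 mulN1r.
by rewrite normrN (exprNn x) 2!exprS !mulN1r opprK mulrCA -!mulrA.
Qed.

(** For nonempty [l], [even_prim l] is a primitive of [odd_prim l]. The parities hold because each
    [half_diff] reverses parity. *)
Definition even_prim l : R -> R := half_diffs l (sign_prim (size l).+1).
Definition odd_prim l : R -> R := half_diffs l (sign_prim (size l)).

Lemma odd_primN l x : odd_prim l (- x) = - odd_prim l x.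
Proof.
rewrite /odd_prim (half_diffs_parity _ _ (sign_prim_parity _)).
by rewrite addSn exprS addnn -signr_odd odd_double expr0 mulr1 mulN1r.
Qed.

Lemma even_primN l x : even_prim l (- x) = even_prim l x.
Proof.
rewrite /even_prim (half_diffs_parity _ _ (sign_prim_parity _)).
by rewrite !addSn addnn -signr_odd /= odd_double expr0 mul1r.
Qed.

Lemma is_derive_half_diff a f g : (forall x : R, is_derive x 1 f (g x)) ->
  forall x, is_derive x 1 (half_diff a f) (half_diff a g x).
Proof.
move=> fg x.
have sh c : is_derive x 1 (fun y => f (y + c)) (g (x + c)).
  have := @is_derive1_comp R f (shift c) x _ _ (fg (x + c)) (is_derive_shift x 1 c).
  by rewrite mulr1.
have := is_deriveZ (2^-1 : R) (is_deriveB (sh a) (sh (- a))).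
set F := (X in is_derive _ _ X _) => d.
rewrite (_ : half_diff a f = F); last by apply/funext => y;
  rewrite /F /half_diff /GRing.scale /= mulrC.
apply: is_derive_eq; rewrite /half_diff /GRing.scale /= mulrC.
by [].
Qed.

Lemma is_derive_half_diffs l m x :
  is_derive x 1 (half_diffs l (sign_prim m.+2)) (half_diffs l (sign_prim m.+1) x).
Proof.
by elim: l x => [|a l IH] x /=; [exact: is_derive_sign_prim|exact: is_derive_half_diff].
Qed.

Lemma is_derive_MVT f g x y : (forall u : R, is_derive u 1 f (g u)) -> x <= y ->
  exists2 u, x <= u <= y & f y - f x = g u * (y - x).
Proof.
move=> fg xy; have [|u] := MVT_segment xy (fun u _ => fg u).
  apply: continuous_subspaceT => u; apply: differentiable_continuous.
  by apply/derivable1_diffP; have := fg u; case.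
by rewrite in_itv /= => ? ?; exists u.
Qed.

(** By induction on [l]: the derivative is a half difference of the function for the tail,
    nonnegative by monotonicity. Lengths 0 and 1 are checked by hand, as the function need not be
    differentiable there. *)
Lemma odd_prim_homo l : all (fun a => 0 <= a) l -> {homo odd_prim l : x y / x <= y}.
Proof.
elim: l => [_ x y xy|a [|b l] IH /andP[a0 l0] x y xy].
- rewrite /odd_prim /=; case: (sgrP x) xy => [->|x0|x0] xy; case: sgrP => //; lra.
- rewrite /odd_prim /= /half_diff /sign_prim /= !expr0 !mulr1 !divr1.
  rewrite ler_pM2r ?invr_gt0 //.
  by case: (ger0P (x + a)); case: (ger0P (x - a)); case: (ger0P (y + a));
    case: (ger0P (y - a)); lra.
have d (u : R) : is_derive u 1 (odd_prim (a :: b :: l))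
  (half_diff a (odd_prim (b :: l)) u).
  exact: (is_derive_half_diffs (a :: b :: l)).
have [u _ E] := is_derive_MVT d xy.
rewrite -subr_ge0 E mulr_ge0 ?subr_ge0 // /half_diff divr_ge0 // subr_ge0.
by apply: IH => //; lra.
Qed.

Lemma odd_prim_ge0 l x : all (fun a => 0 <= a) l -> 0 <= x -> 0 <= odd_prim l x.
Proof.
move=> l0 x0; have := odd_prim_homo l0 x0.
have : odd_prim l 0 = 0 by have := odd_primN l 0; rewrite oppr0; lra.
by move=> ->.
Qed.

Lemma even_prim_convex l x y : all (fun a => 0 <= a) l -> x <= y ->
  odd_prim l x * (y - x) <= even_prim l y - even_prim l x.
Proof.
case: l => [_ xy|a l l0 xy].
  rewrite /odd_prim /even_prim /= !expr0 !mulr1 !divr1.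
  case: (sgrP x) xy => [->|x0|x0] xy; case: (ger0P y) => y0;
    rewrite ?normr0 ?(gtr0_norm x0) ?(ltr0_norm x0); lra.
have d (u : R) : is_derive u 1 (even_prim (a :: l)) (odd_prim (a :: l) u).
  exact: (is_derive_half_diffs (a :: l)).
have [u /andP[xu _] ->] := is_derive_MVT d xy.
by rewrite ler_wpM2r ?subr_ge0 // odd_prim_homo.
Qed.

Lemma even_prim_le l x y : all (fun a => 0 <= a) l -> `|x| <= `|y| ->
  even_prim l x <= even_prim l y.
Proof.
move=> l0; have E u : even_prim l u = even_prim l `|u|.
  by case: ger0P => // _; rewrite even_primN.
rewrite (E x) (E y) => xy; rewrite -subr_ge0; apply: le_trans (even_prim_convex l0 xy).
by rewrite mulr_ge0 ?subr_ge0 ?odd_prim_ge0.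
Qed.

(** By convexity the value at a hook length [w] is at most [(even_prim l (w + 2) - even_prim l w) /
    2]. Consecutive hook lengths differ by 2, so these bounds telescope; the overshoot at the ends
    is why the sides are [n.+1]. *)
Lemma hook_bound_le (ns : seq nat) (e : nat) :
  (hook_bound ns e)%:R <= odd_prim [seq n.+1%:R | n <- ns] e%:R.
Proof.
elim: ns e => [|a ns IH] e /=.
  by rewrite /odd_prim /=; case: e => [|e]; rewrite ?sgr0 // gtr0_sg ?ltr0n.
set l := [seq _ | _ <- ns] in IH *.
have l0 : all (fun a : R => 0 <= a) l by apply/allP => _ /mapP[m _ ->].
pose h t : R := even_prim l ((a + e)%:R - 2 * t%:R + 1).
apply: (@le_trans _ _ (\sum_(t < minn a e) ((h t - h t.+1) / 2))).
  rewrite natr_sum; apply: ler_sum => t _; apply: le_trans (IH _) _.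
  have tm : (t < minn a e)%N := ltn_ord t.
  have -> : (a + e - (t : nat).*2.+1)%:R = (a + e)%:R - 2 * (t : nat)%:R - 1 :> R.
    rewrite natrB; last by move: tm; rewrite ltn_min => /andP[? ?]; lia.
    by rewrite -natr1 -mul2n natrM; ring.
  set w := (_ - 1 : R).
  have ww : w <= w + 2 by lra.
  have := even_prim_convex l0 ww.
  rewrite /h -[(t : nat).+1%:R]natr1 (_ : (a + e)%:R - 2 * (t : nat)%:R + 1 = w + 2);
    last by rewrite /w; ring.
  rewrite (_ : (a + e)%:R - 2 * ((t : nat)%:R + 1) + 1 = w); last by rewrite /w; ring.
  rewrite (_ : w + 2 - w = 2); last ring.
  by rewrite ler_pdivlMr.
rewrite -mulr_suml (_ : \sum_(t < _) _ = h 0%N - h (minn a e)); last first.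
  rewrite -[RHS]opprB -(telescope_sumr h (leq0n _)) -sumrN big_mkord.
  by apply: eq_bigr => t _; rewrite opprB.
have -> : odd_prim (a.+1%:R :: l) e%:R =
    (even_prim l (e%:R + a.+1%:R) - even_prim l (e%:R - a.+1%:R)) / 2 by [].
rewrite ler_pM2r ?invr_gt0 // /h mulr0 subr0 natrD -[a.+1%:R]natr1.
rewrite (_ : a%:R + e%:R + 1 = e%:R + (a%:R + 1)); last by ring.
rewrite lerD2l lerN2; apply: even_prim_le => //.
case: (leqP a e) => ae.
  have : (a%:R : R) <= e%:R by rewrite ler_nat.
  by move=> ?; rewrite [leRHS]ger0_norm; [rewrite ler_norml; lra | lra].
have : (e%:R : R) < a%:R by rewrite ltr_nat.
by move=> ?; rewrite [leRHS]ger0_norm; [rewrite ler_norml; lra | lra].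
Qed.

End HalfDiffTheory.

Section CubeSection.
Variable R : realType.
Implicit Types (l : seq R) (a b x y : R).

(* The (k-1)-volume of the section by the hyperplane of zero coordinate sum of
   the box with side lengths l, projected along one axis: the value at 0 of the
   convolution of the indicators of the centred intervals. *)
Definition box_section l : R := half_diffs l (sign_prim (size l).-1) 0.

Lemma box_section_cons a l : box_section (a :: l) = odd_prim l a.
Proof.
rewrite /box_section /= /half_diff add0r sub0r -/(odd_prim l) odd_primN; lra.
Qed.

Lemma box_section_cons2 a b l :
  box_section [:: a, b & l] = (even_prim l (a + b) - even_prim l (a - b)) / 2.
Proof.
rewrite /box_section /= /half_diff !add0r -/(even_prim l).
rewrite (_ : - a + b = - (a - b)); last by ring.
rewrite (_ : - a - b = - (a + b)); last by ring.
by rewrite !even_primN; lra.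
Qed.

Lemma box_section_perm l l' : perm_eq l l' -> box_section l = box_section l'.
Proof.
by move=> ll; rewrite /box_section (perm_size ll) (half_diffs_perm _ ll).
Qed.

(** With [a + b] fixed only [even_prim l (a - b)] varies, and it increases with the absolute value
    of [a - b]. *)
Lemma box_section_balance a b a' b' l : all (fun c => 0 <= c) l ->
  a + b = a' + b' -> `|a' - b'| <= `|a - b| ->
  box_section [:: a, b & l] <= box_section [:: a', b' & l].
Proof.
move=> l0 ab h; rewrite !box_section_cons2 ab ler_pM2r ?invr_gt0 //.
by rewrite lerD2l lerN2 even_prim_le.
Qed.

(** Raise a side below the mean to [m] and compensate with one above it: the two get closer, and
    fewer sides differ from [m]. *)
Lemma box_section_le_mean l m : all (fun c => 0 <= c) l ->
  \sum_(c <- l) c = (size l)%:R * m -> box_section l <= box_section (nseq (size l) m).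
Proof.
move: {2}(count (predC1 m) l) (leqnn (count (predC1 m) l)) => N.
elim: N l => [|N IH] l hN l0 sl.
  have /all_pred1P <- // : all (pred1 m) l.
  by move: hN; rewrite leqn0 eqn0Ngt -has_count has_predC negbK.
case: (boolP (all (pred1 m) l)) => [/all_pred1P <-//|nall].
have extreme (s : R) : s != 0 -> has (fun c => 0 < s * (c - m)) l.
  move=> s0; apply: contraNT nall => /hasPn le; apply/allP => c cl.
  have : \sum_(c <- l) (s * (m - c)) == 0.
    rewrite -mulr_sumr big_split/= big_const_seq count_predT iter_addr_0 sumrN sl.
    by rewrite mulr_natl subrr mulr0.
  rewrite big_seq psumr_eq0 => [/allP/(_ _ cl)|v /le]; last first.
    by rewrite -leNgt -(opprB v) mulrN oppr_ge0.
  by rewrite cl /= mulf_eq0 (negbTE s0) subr_eq0 eq_sym.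
have [w wl mw] : exists2 w, w \in l & m < w.
  by have /hasP[w wl] := extreme 1 (oner_neq0 R); rewrite mul1r subr_gt0; exists w.
have [u ul um] : exists2 u, u \in l & u < m.
  have n1 : -1 != 0 :> R by rewrite oppr_eq0 oner_neq0.
  by have /hasP[u ul] := extreme _ n1; rewrite mulN1r oppr_gt0 subr_lt0; exists u.
have uw : u != w by rewrite lt_eqF // (lt_trans um).
pose l' := rem w (rem u l).
have wl' : w \in rem u l.
  by move: wl; rewrite (perm_mem (perm_to_rem ul)) inE eq_sym (negbTE uw).
have pl : perm_eq l [:: u, w & l'].
  by apply: perm_trans (perm_to_rem ul) _; rewrite perm_cons perm_to_rem.
pose l2 := [:: m, u + w - m & l'].
have l'0 : all (fun c => 0 <= c) l'.
  by move: l0; rewrite (perm_all _ pl) /= => /and3P[].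
have u0 : 0 <= u by move/allP: l0; exact.
have sz : size l = size l2 by rewrite (perm_size pl).
rewrite (box_section_perm pl) sz;
  apply: le_trans (box_section_balance l'0 (_ : _ = m + (u + w - m)) _) _.
- by ring.
- by rewrite [leRHS]distrC (gtr0_norm (_ : 0 < w - u)) ?ler_norml; lra.
apply: IH.
- rewrite /l2 /= eqxx add0n; move: hN; rewrite (permP pl) /= (lt_eqF um) (gt_eqF mw) /=.
  by rewrite add1n add1n ltnS; apply: leq_trans; rewrite -add1n leq_add2r leq_b1.
- by rewrite /l2 /= l'0 andbT; apply/andP; split; lra.
rewrite -sz -sl (perm_big _ pl) /l2 !big_cons /=; ring.
Qed.

Lemma half_diffs_scale l m c x : 0 < c ->
  half_diffs [seq c * a | a <- l] (sign_prim m) (c * x) =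
    c ^+ m * half_diffs l (sign_prim m) x.
Proof.
move=> c0; elim: l x => [|a l IH] x /=.
  case: m => [|m]; rewrite /sign_prim; first by rewrite expr0 mul1r sgrM gtr0_sg // mul1r.
  by rewrite normrM gtr0_norm // exprMn exprS; ring.
by rewrite /half_diff -mulrDr -mulrBr !IH; ring.
Qed.

Lemma box_section_nseq k m : 0 < m ->
  box_section (nseq k m) = m ^+ k.-1 * box_section (nseq k 1).
Proof.
move=> m0; rewrite /box_section !size_nseq -half_diffs_scale // mulr0.
by rewrite map_nseq mulr1.
Qed.

End CubeSection.

(** * The constant [sigma] as a section of the unit cube *)

Section SigmaSection.
Variable R : realType.
Implicit Types (l : seq R) (f g : R -> R) (a b x y : R).
Local Notation mu := (@lebesgue_measure R).

Lemma interval_indic1E : interval_indic (1 : R) = \1_([set` `[(- (1 / 2)), (1 / 2)]]).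
Proof.
rewrite /interval_indic; congr (\1_ _); apply/seteqP; split => y /=.
  by rewrite in_itv /= ler_norml.
by rewrite in_itv /= ler_norml.
Qed.

Lemma convolution_indic1 g x : convolution (interval_indic 1) g x =
  \int[mu]_(y in `[(- (1 / 2)), (1 / 2)]) g (x - y).
Proof.
rewrite /convolution interval_indic1E [RHS]Rintegral_mkcond patch_indic.
by apply: eq_Rintegral => y _; rewrite /= mulrC.
Qed.

(** Both sides are the tent function, the positive part of [1 - |x|], found by hand because the
    indicator is not continuous. The factor 2 appears because [half_diff] shifts by a whole side,
    not by half of it. *)
Lemma convolution_indic1_indic1 x : convolution (interval_indic 1) (interval_indic 1) x =
  half_diffs (nseq 2 1) (sign_prim 1) (2 * x).
Proof.
rewrite convolution_indic1 /Rintegral.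
rewrite (_ : (fun y => (interval_indic 1 (x - y))%:E) =
    (fun y => (\1_([set` `[x - 1 / 2, x + 1 / 2]]) y)%:E)); last first.
  apply/funext => y; rewrite interval_indic1E !indicE; congr (_%:R%:E).
  by apply: congr1; apply/idP/idP; rewrite !inE /= !in_itv /=; lra.
rewrite integral_indic; try exact: measurable_itv.
have -> : [set` `[x - 1 / 2, x + 1 / 2]] `&` [set` `[(- (1 / 2)), (1 / 2)]] =
   (if 0 <= x then [set` `[x - 1 / 2, 1 / 2]] else [set` `[- (1 / 2), x + 1 / 2]]).
  have xN : (0 <= x) = false -> x < 0 by move/negbT; rewrite -ltNge.
  apply/seteqP; split => y; case: ifP => [x0|/xN x0]; rewrite /= !in_itv /=.
  - by move=> [/andP[h1 h2] /andP[h3 h4]]; apply/andP; split.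
  - by move=> [/andP[h1 h2] /andP[h3 h4]]; apply/andP; split.
  - by move=> /andP[h1 h2]; split; apply/andP; split; lra.
  - by move=> /andP[h1 h2]; split; apply/andP; split; lra.
rewrite /half_diffs /= /half_diff /sign_prim !expr0 !mulr1 !divr1.
have -> : fine (mu (if 0 <= x
  then [set` `[x - 1 / 2, 1 / 2]] else [set` `[- (1 / 2), x + 1 / 2]])) =
  if `|x| < 1 then 1 - `|x| else 0.
  case: (ger0P x) => x0; rewrite lebesgue_measure_itv /= lte_fin.
    rewrite (_ : (x - 1 / 2 < 1 / 2) = (x < 1)); last by apply/idP/idP; lra.
    by case: ifP => // _; rewrite -EFinB /=; lra.
  rewrite (_ : (- (1 / 2) < x + 1 / 2) = (- x < 1)); last by apply/idP/idP; lra.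
  by case: ifP => // _; rewrite -EFinB /=; lra.
case: ltP; case: (ger0P x); case: (ger0P (2 * x + 1 + 1)); case: (ger0P (2 * x + 1 - 1));
 case: (ger0P (2 * x - 1 + 1)); case: (ger0P (2 * x - 1 - 1)); lra.
Qed.

Lemma continuous_half_diffs l f : continuous f -> continuous (half_diffs l f).
Proof.
move=> cf; elim: l => //= a l IH x.
rewrite /half_diff; apply: cvgMl.
have sh b : (half_diffs l f (y + b) @[y --> x]) --> half_diffs l f (x + b).
  apply: (@continuous_comp _ _ _ (fun y => y + b) (half_diffs l f)); last exact: IH.
  by apply: cvgD; [exact: cvg_id | exact: cvg_cst].
exact: cvgB (sh a) (sh (- a)).
Qed.

Lemma continuous_sign_prim m : continuous (@sign_prim R m.+1).
Proof.
move=> x; rewrite /sign_prim; apply: cvgMl; apply: cvgM; first exact: cvg_norm.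
exact: exprn_continuous.
Qed.

Lemma Rintegral_half_diffs l m x :
  \int[mu]_(y in `[(- (1 / 2)), (1 / 2)]) half_diffs l (sign_prim m.+1) (2 * (x - y)) =
  half_diffs (1 :: l) (sign_prim m.+2) (2 * x).
Proof.
pose aff (y : R) : R := 2 * (x - y).
have daff (y : R) : is_derive y 1 aff (- 2).
  have := is_deriveZ (2 : R) (is_deriveB (is_derive_cst x y 1) (is_derive_id y 1)).
  set F := (X in is_derive _ _ X _) => d.
  rewrite (_ : aff = F) //; apply: is_derive_eq; rewrite /GRing.scale /=; ring.
(* Dividing by [- 2] undoes the inner derivative of [aff]; the increment of [F] over the interval is
   then a half difference. *)
pose F (y : R) := - (half_diffs l (sign_prim m.+2) (aff y) / 2).
have dF (y : R) : is_derive y 1 F (half_diffs l (sign_prim m.+1) (aff y)).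
  have := is_deriveZ (- 2^-1 : R)
    (is_derive1_comp (is_derive_half_diffs l m (aff y)) (daff y)).
  set F' := (X in is_derive _ _ X _) => d.
  rewrite (_ : F = F'); last by apply/funext => u; rewrite /F /F' /= mulrC -mulNr.
  by apply: is_derive_eq; rewrite /GRing.scale /= mulrCA mulrA; field.
have cF : continuous F.
  by move=> y; apply: differentiable_continuous; apply/derivable1_diffP; case: (dF y).
rewrite /Rintegral (@continuous_FTC2 R _ F) /=.
- rewrite /half_diff /F /aff.
  rewrite (_ : 2 * (x - 1 / 2) = 2 * x - 1); last by field.
  rewrite (_ : 2 * (x - - (1 / 2)) = 2 * x + 1); last by field.
  by ring.
- by lra.
- apply: continuous_subspaceT => y.
  apply: (@continuous_comp _ _ _ aff (half_diffs l (sign_prim m.+1))).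
    by apply: differentiable_continuous; apply/derivable1_diffP; case: (daff y).
  by apply: continuous_half_diffs; exact: continuous_sign_prim.
- split.
  + by move=> y _; case: (dF y).
  + exact: cvg_at_right_filter (cF _).
  + exact: cvg_at_left_filter (cF _).
by move=> y _; rewrite derive1E; case: (dF y).
Qed.

Lemma sigmaE k : (2 < k)%N -> sigma R k = box_section (nseq k 1).
Proof.
move=> k2; have conv m x : convolution_pow (interval_indic (1 : R)) m.+2 x =
    half_diffs (nseq m.+2 1) (sign_prim m.+1) (2 * x).
  elim: m x => [|m IH] x; first exact: convolution_indic1_indic1.
  rewrite /convolution_pow iterS -/(convolution_pow _ m.+2) convolution_indic1.
  under eq_Rintegral do rewrite IH.
  by rewrite Rintegral_half_diffs.
case: k k2 => [|[|k]] // _.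
by rewrite /sigma conv mulr0 /box_section size_nseq.
Qed.

End SigmaSection.

Lemma box_section_nseq_ge0 (R : realType) k (m : R) : 0 <= m ->
  0 <= box_section (nseq k.+1 m).
Proof.
by move=> m0; rewrite /= box_section_cons odd_prim_ge0 // all_nseq m0 orbT.
Qed.

(** Raising the argument of [odd_prim] by one gives the section of the box with all sides [n.+1],
    which is compared with the cube of the same total side length; homogeneity extracts the
    power. *)
Lemma hook_bound_le_sigma (R : realType) (ns : seq nat) : (2 < size ns)%N ->
  (hook_bound (behead ns) (head 0%N ns))%:R <=
  sigma R (size ns) / (size ns)%:R ^+ (size ns).-1 * (sumn ns + size ns)%:R ^+
    (size ns).-1.
Proof.
case: ns => [//|n0 ns] sz; set k := size (n0 :: ns) in sz *.
have k0 : 0 < k%:R :> R by rewrite ltr0n.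
pose l : seq R := [seq n.+1%:R | n <- n0 :: ns].
have l0 : all (fun c => 0 <= c) l by apply/allP => _ /mapP[m _ ->].
have sl : size l = k by rewrite size_map.
rewrite -mulrA [_^-1 * _]mulrC -expr_div_n mulrC sigmaE // -box_section_nseq; last first.
  by rewrite divr_gt0 // ltr0n /= addnS.
rewrite -sl; apply: le_trans (box_section_le_mean l0 _); last first.
  rewrite sl mulrCA divff ?gt_eqF // mulr1 /l big_map natrD /k.
  elim: (n0 :: ns) => [|m s IH] /=; first by rewrite big_nil addr0.
  by rewrite big_cons IH natrD -!natr1; ring.
rewrite /l /= box_section_cons; apply: le_trans (hook_bound_le _ _ _) _.
by apply: odd_prim_homo; [move: l0 => /= /andP[]|rewrite ler_nat].
Qed.

(** * Depths of scaled sets *)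

Lemma find_iota_eq (P : pred nat) (t K : nat) : (forall s, (s < t)%N -> ~~ P s) -> P t ->
  (t <= K)%N -> find P (iota 0 K.+1) = t.
Proof.
move=> nP Pt tK; have h : has P (iota 0 K.+1) by apply/hasP; exists t; rewrite ?mem_iota.
have fK : (find P (iota 0 K.+1) < K.+1)%N by rewrite -[ltnRHS](size_iota 0) -has_find.
apply/eqP; rewrite eqn_leq; apply/andP; split; rewrite leqNgt; apply/negP => lt.
  by have := before_find 0 lt; rewrite nth_iota ?add0n // Pt.
have := nth_find 0 h; rewrite nth_iota // add0n; apply/negP; exact: nP.
Qed.

Section Scale.
Variables (p k : nat) (X : finType) (v : X -> int) (e u : 'I_k -> nat) (d K : nat).
Hypotheses (pp : prime p) (pu : forall i, coprime p (u i)).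
Let z i x : int := (p ^ e i * u i)%N%:Z * v x.

(* Up to one level, the depth below which the class of x has fewer than
   |X| / d^r elements. *)
Definition depth r (x : X) : nat :=
  find (fun j => cong_card p v j (v x) * d ^ r < #|X|)%N (iota 0 K.+1).

(** The truncated subtraction is right: for [s <= e i] the factor [p ^ e i] makes the congruence
    trivial. *)
Lemma cong_scale i s x y : cong p s (z i x) (z i y) = cong p (s - e i) (v x) (v y).
Proof.
rewrite /cong /z -mulrBr !dvdzE abszM /=.
have pe : (0 < p ^ e i)%N by rewrite expn_gt0 prime_gt0.
case: (leqP s (e i)) => [se|es].
  rewrite (eqP se) expn0 dvd1n -mulnA; apply: dvdn_mulr; exact: dvdn_exp2l.
rewrite -mulnA -{1}(subnKC (ltnW es)) expnD dvdn_pmul2l // Gauss_dvdr //.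
by rewrite coprimeXl.
Qed.

Hypothesis zK : forall i x y, cong p K (z i x) (z i y) -> x = y.

(** At the cut some coordinate is light, hence all are; at smaller depths none is. So the depth of
    [x i], measured in [v], is that of the cut minus [e i]. *)
Lemma aligned_depth r (x : {ffun 'I_k -> X}) : (0 < k)%N -> (0 < d)%N ->
  (d ^ r < #|X|)%N ->
  ~~ misaligned p z d K r (fun i => z i (x i)) ->
  exists2 c, (c <= K.+1)%N & forall i, (depth r (x i) + e i = c)%N.
Proof.
move=> k0 d0 dn al; set G := fun i => _ in al.
have n0 : (0 < #|X|)%N by apply: leq_ltn_trans dn.
have cE i s : cnt p z i s (G i) = cong_card p v (s - e i) (v (x i)).
  by apply: eq_card => y; rewrite !inE cong_scale.
exists (tau p z d K r G); first exact: tau_le.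
have [tK /existsP[i0 l0]] := tau_light zK G k0 dn.
have all_light i : (cnt p z i (tau p z d K r G) (G i) * d ^ r < #|X|)%N.
  rewrite ltnNge; apply/negP => h; case/negP: al.
  by apply/existsP; exists i0; apply/existsP; exists i; rewrite l0.
move=> i; have := all_light i; rewrite cE => hi.
(* The subtraction is exact: at depth 0 the class is all of [X], which is not light. *)
have et : (e i <= tau p z d K r G)%N.
  rewrite leqNgt; apply/negP => /ltnW; rewrite -subn_eq0 => /eqP e0.
  move: hi; rewrite e0 (_ : cong_card p v 0 _ = #|X|).
    by rewrite ltnNge leq_pmulr // expn_gt0 d0.
  by apply: eq_card => y; rewrite !inE cong0.
rewrite /depth (@find_iota_eq _ (tau p z d K r G - e i)) ?subnK //.
  move=> s; rewrite ltn_subRL addnC => /tau_before; rewrite negb_exists => /forallP/(_ i).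
  by rewrite cE addnK.
exact: leq_trans (leq_subr _ _) tK.
Qed.

End Scale.

Lemma card_fset_ffun (k : nat) (a : 'I_k -> int) (S : {fset int}) :
  num_solutions a S = #|[pred x : {ffun 'I_k -> S} | \sum_(i < k) a i * val (x i) == 0]|.
Proof. by apply: eq_card => x; rewrite !inE. Qed.

Lemma expr_near1 (R : realFieldType) (m : nat) (t : R) : 0 <= t <= 1 ->
  (1 + t) ^+ m <= 1 + 3 ^+ m * t.
Proof.
move=> /andP[t0 t1]; elim: m => [|m IH]; first by rewrite expr0 expr0 mul1r lerDl.
rewrite exprSr; apply: (@le_trans _ _ ((1 + 3 ^+ m * t) * (1 + t))).
  by rewrite ler_wpM2r // addr_ge0.
have h1 : 1 <= 3 ^+ m :> R by rewrite exprn_ege1 //; lra.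
rewrite exprSr; move: (3 ^+ m) h1 => c c1.
have h2 : t <= c * t by rewrite -[leLHS]mul1r ler_wpM2r.
have h3 : c * t * t <= c * t by rewrite -[leRHS]mulr1 ler_wpM2l // mulr_ge0 //; lra.
by rewrite mulrDl mul1r mulrDr mulr1; lra.
Qed.

(** Absorbs the extra [k] in the total side length, due to the sides [n.+1]. *)
Lemma shifted_power_le (R : archiRealFieldType) (C eps : R) (k m : nat) : 0 <= C ->
  0 < eps ->
  exists N : nat, forall n : nat, (N <= n)%N ->
    C * (n + k)%:R ^+ m <= (C + eps) * n%:R ^+ m.
Proof.
move=> C0 e0; pose b : R := C * 3 ^+ m * k%:R / eps.
have b0 : 0 <= b by rewrite /b divr_ge0 ?(ltW e0) // !mulr_ge0 ?exprn_ge0.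
exists (maxn k.+1 (Num.bound b)) => n; rewrite geq_max => /andP[kn bn].
have n0 : 0 < n%:R :> R by rewrite ltr0n (leq_trans _ kn).
have t01 : 0 <= (k%:R / n%:R : R) <= 1.
  by rewrite divr_ge0 //= ler_pdivrMr // mul1r ler_nat ltnW.
have -> : (n + k)%:R = n%:R * (1 + k%:R / n%:R) :> R.
  by rewrite natrD mulrDr mulr1 mulrCA divff ?mulr1 // gt_eqF.
rewrite exprMn mulrCA mulrC ler_wpM2r ?exprn_ge0 //.
apply: le_trans (ler_wpM2l C0 (expr_near1 m t01)) _; rewrite mulrDr mulr1 lerD2l.
rewrite 2!mulrA ler_pdivrMr // [leRHS]mulrC -ler_pdivrMr //.
by apply: le_trans (ltW (archi_boundP b0)) _; rewrite ler_nat.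
Qed.

(** Any [K] bounding all differences works for every [p], since [K < p ^ K]. *)
Lemma exists_separating_depth (k : nat) (X : finType) (z : 'I_k -> X -> int) :
  (forall i, injective (z i)) -> exists K : nat, forall p i x y, (1 < p)%N ->
    cong p K (z i x) (z i y) -> x = y.
Proof.
move=> zi; pose K := (\sum_i \sum_x \sum_y `|z i x - z i y|)%N.
exists K => p i x y p1; rewrite /cong dvdzE /= => h; apply: (zi i); apply/eqP.
rewrite -subr_eq0 -absz_eq0; apply/negPn/negP; rewrite -lt0n => /dvdn_leq/(_ h).
rewrite leqNgt => /negP; apply; apply: leq_ltn_trans (ltn_expl K p1).
by rewrite /K (bigD1 i)//= (bigD1 x)//= (bigD1 y)//= -!addnA leq_addr.
Qed.

Theorem theorem4p5 (R : realType) (k : nat) (hk : (3 <= k)%N)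
    (eps : R) (heps : 0 < eps) :
  exists2 a : 'I_k -> int, (forall i, a i != 0) &
  exists f : nat -> R, f n @[n --> \oo] --> (0 : R) /\
  exists N : nat, forall S : {fset int}, (N <= #|` S|)%N ->
    (num_solutions a S)%:R <=
      (sigma R k / k%:R ^+ k.-1 + eps) * #|` S|%:R ^+ k.-1
      + f #|` S| * #|` S|%:R ^+ k.-1.
Proof.
have k0 : (0 < k)%N by apply: leq_trans hk.
set C := sigma R k / k%:R ^+ k.-1.
have C0 : 0 <= C.
  rewrite /C sigmaE // divr_ge0 ?exprn_ge0 //.
  by rewrite -[k in nseq k](prednK k0) box_section_nseq_ge0.
have e4 : 0 < eps / 4 by lra.
have e2 : 0 < eps / 2 by lra.
have [d [Rm [Pm [d1 rare]]]] := misaligned_rare hk e4.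
have [p Pp pp] := prime_above Pm.
have [q pq qq] := prime_above (maxn Pm p).
have [Pq {}pq] : (Pm < q)%N /\ p != q.
  by move: pq; rewrite gtn_max => /andP[-> /ltn_eqF ->].
have [N0 hN0] := shifted_power_le k k.-1 C0 e2.
pose zp (X : {fset int}) (i : 'I_k) (x : X) : int :=
  (p ^ i * q ^ (i == 0 :> nat))%N%:Z * val x.
(* The same map in the form [aligned_depth] expects, the power of the prime in question coming
   first. *)
pose zq (X : {fset int}) (i : 'I_k) (x : X) : int :=
  (q ^ (i == 0 :> nat) * p ^ i)%N%:Z * val x.
have pos i j : (0 < p ^ i * q ^ j)%N by rewrite muln_gt0 !expn_gt0 !prime_gt0.
exists (fun i => (p ^ i * q ^ (i == 0 :> nat))%N%:Z).
  by move=> i; rewrite eqz_nat -lt0n.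
(* For large [S] all lower order terms fit into [eps], so the error function can be zero. *)
exists (fun=> 0); split; first exact: cvg_cst.
(* More than [d ^ Rm] elements make a light level exist for every [r <= Rm]. *)
exists (maxn N0 (d ^ Rm).+1) => S; rewrite geq_max => /andP[nN0 nd].
have nE : #|` S| = #|{: S}| by rewrite cardfE.
rewrite mul0r addr0 card_fset_ffun; rewrite nE in nN0 nd *.
set n := #|{: S}| in nN0 nd *.
have n0 : (0 < n)%N by apply: leq_trans nd.
have zpi i : injective (zp S i).
  by move=> x y /mulfI E; apply/val_inj/E; rewrite eqz_nat -lt0n.
have zpq i x : zq S i x = zp S i x by rewrite /zq mulnC.
have zqi i : injective (zq S i) by move=> x y; rewrite !zpq; exact: zpi.
have [Kp hKp] := exists_separating_depth zpi.
have [Kq hKq] := exists_separating_depth zqi.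
have [rp /andP[_ rpR] badp] := rare p Kp S (zp S) pp (ltnW Pp) n0 zpi.
have [rq /andP[_ rqR] badq] := rare q Kq S (zq S) qq (ltnW Pq) n0 zqi.
have dr r : (r <= Rm)%N -> (d ^ r < n)%N.
  by move=> rR; apply: leq_ltn_trans nd; rewrite leq_exp2l.
pose sol (x : {ffun 'I_k -> S}) := \sum_i zp S i (x i) == 0.
pose Bp (x : {ffun 'I_k -> S}) := misaligned p (zp S) d Kp rp (fun i => zp S i (x i)).
pose Bq (x : {ffun 'I_k -> S}) := misaligned q (zq S) d Kq rq (fun i => zq S i (x i)).
pose good := [pred x | [&& sol x, ~~ Bp x & ~~ Bq x]].
(* Depth plus exponent is constant along a good solution. Reversing the depth makes [g1] grow by one
   per coordinate, and [g2] larger by one at coordinate 0 only. *)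
pose g1 (x : S) := (Kp.+1 - depth p (fun y : S => val y) d Kp rp x)%N.
pose g2 (x : S) := (Kq.+1 - depth q (fun y : S => val y) d Kq rq x)%N.
have cop i : coprime p (q ^ i) by rewrite coprimeXr // prime_coprime // dvdn_prime2.
have coq i : coprime q (p ^ i) by rewrite coprimeXr // prime_coprime // dvdn_prime2 //
  eq_sym.
have graded x : good x ->
  \sum_(i < k) (p ^ i * q ^ (i == 0 :> nat))%N%:Z * val (x i) = 0 /\
    exists C1 C2 : nat, forall i : 'I_k,
      g1 (x i) = (C1 + i)%N /\ g2 (x i) = (C2 + (i == 0 :> nat))%N.
  move=> /and3P[/eqP s0 alp alq]; split; first exact: s0.
  have [cp cpK hcp] := aligned_depth pp (fun i : 'I_k => cop (i == 0 :> nat))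
    (fun i x y => hKp p i x y (prime_gt1 pp)) k0 (ltnW d1) (dr _ rpR) alp.
  have [cq cqK hcq] := aligned_depth qq (fun i : 'I_k => coq i)
    (fun i x y => hKq q i x y (prime_gt1 qq)) k0 (ltnW d1) (dr _ rqR) alq.
  exists (Kp.+1 - cp)%N, (Kq.+1 - cq)%N => i; rewrite /g1 /g2.
  have := hcp i; have := hcq i; move: (depth _ _ _ _ _ _) (depth _ _ _ _ _ _) => D D' /=.
  by move: cpK cqK; clear; case: (_ == _) => /=; lia.
have [ns [sns sumns] hns] :=
  graded_solutions_le hk (prime_gt0 pp) (prime_gt0 qq) val_inj graded.
have cover : (#|[pred x | sol x]|
   <= #|[pred x | sol x && Bp x]| + #|[pred x | sol x && Bq x]| + #|good|)%N.
  rewrite -!sum1_card big_mkcond [X in (_ <= X + _ + _)%N]big_mkcond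
    [X in (_ <= _ + X + _)%N]big_mkcond.
  rewrite [X in (_ <= _ + _ + X)%N]big_mkcond -!big_split /=; apply: leq_sum => x _.
  rewrite !inE.
  by case: (sol x) => //=; case: (Bp x) => //=; case: (Bq x).
have badq' : #|[pred x | sol x && Bq x]|%:R <= eps / 4 * n%:R ^+ k.-1 :> R.
  rewrite (@eq_card _ _ [pred x : {ffun 'I_k -> S} | (\sum_i zq S i (x i) == 0) && Bq x]);
    first exact: badq.
  move=> x; rewrite !inE; congr (_ && _); congr (_ == _).
  by apply: eq_bigr => i _; rewrite zpq.
have hs := hook_bound_le_sigma R (ns := ns); rewrite sns -/C sumns in hs.
have main : #|good|%:R <= (C + eps / 2) * n%:R ^+ k.-1 :> R.
  apply: le_trans (hN0 _ nN0); apply: le_trans (hs hk).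
  by rewrite ler_nat.
move: cover; rewrite -(ler_nat R) !natrD => cover; apply: le_trans cover _.
apply: le_trans (lerD (lerD badp badq') main) _.
by rewrite -!mulrDl ler_wpM2r ?exprn_ge0 //; lra.
Qed.
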